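(* Let $\mu$ be a measure on $\mathbb{R}$ with compact support, let $E=\sigma_{\mathrm{ess}}(\mu)$ and suppose $C(E)>0$. Suppose the equilibrium measure $\rho_E$ is absolutely continuous with respect to $\mu$ (equivalently, $d\mu=w\,d\rho_E+d\mu_s$ with $\mu_s$ singular with respect to $\rho_E$ and $w(x)>0$ for $\rho_E$-a.e. $x$). Then $\mu$ is regular. *)

(* Defs.v *)
From HB Require Import structures.
From mathcomp Require Import all_boot all_order all_algebra.
From mathcomp Require Import all_classical all_reals all_analysis.
Set Implicit Arguments. Unset Strict Implicit. Unset Printing Implicit Defensive.
Import Order.TTheory GRing.Theory Num.Theory.
Import numFieldNormedType.Exports.
Local Open Scope classical_set_scope.
Local Open Scope ring_scope.

Section potential.
Variable R : realType.

Definition msupp (mu : set R -> \bar R) : set R :=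
  [set x | forall e : R, 0 < e -> (0 < mu (ball x e))%E].

Definition sigma_ess (mu : set R -> \bar R) : set R :=
  [set x | msupp mu x /\
     forall e : R, 0 < e -> exists y, [/\ msupp mu y, y != x & `|x - y| < e]].

Definition logkernel (x y : R) : \bar R :=
  if x == y then +oo%E else (- ln `|x - y|)%:E.

Definition log_energy (nu : set R -> \bar R) : \bar R :=
  (\int[nu]_x \int[nu]_y logkernel x y)%E.

Definition prob_on (E : set R) (nu : probability R R) : Prop :=
  nu (~` E) = 0%E.

Definition robin (E : set R) : \bar R :=
  ereal_inf [set log_energy nu | nu in [set nu : probability R R | prob_on E nu]].

Definition capacity (E : set R) : \bar R := expeR (- robin E)%E.

Definition equilibrium_measure (E : set R) (rho : probability R R) : Prop :=
  prob_on E rho /\ log_energy rho = robin E.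

(* ||P_n||^2 in L^2(mu), P_n the monic orthogonal polynomial of degree n,
   given by its extremal property: the minimal L^2(mu)-norm squared of a
   monic polynomial of degree n *)
Definition monic_L2_min (mu : set R -> \bar R) (n : nat) : \bar R :=
  ereal_inf [set (\int[mu]_x ((p.[x]) ^+ 2)%:E)%E |
             p in [set p : {poly R} | p \is monic /\ size p = n.+1]].

(* mu is regular (Stahl--Totik, with E = sigma_ess mu):
   lim_n ||P_n||_{L^2(mu)}^{1/n} = C(E) *)
Definition regular_measure (mu : set R -> \bar R) : Prop :=
  (fun n : nat => ((fine (monic_L2_min mu n)) `^ (n.*2%:R)^-1)%:E)
    @ \oo --> capacity (sigma_ess mu).

End potential.

(* Main.v *)
Require Import Defs.
From HB Require Import structures.
From mathcomp Require Import all_boot all_order all_algebra.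
From mathcomp Require Import all_classical all_reals all_analysis.
From mathcomp Require Import measurable_realfun complex.
From mathcomp Require Import ring lra.
Import Order.TTheory GRing.Theory Num.Theory.
Import numFieldNormedType.Exports.
Local Open Scope classical_set_scope.
Local Open Scope ring_scope.
Set Implicit Arguments.
Unset Strict Implicit.

(** Write C = exp(-V) for the capacity of E, V = robin E, and U for the
    logarithmic potential of the equilibrium measure rho.

    Lower bound. Since rho minimises the energy, U <= V holds rho-almost
    everywhere, hence everywhere: U is lower semicontinuous, and on a gap of
    the set {U <= V} it is a mixture of convex functions.  If a monic p of
    degree n had an L^2(mu)-norm below c^n with c < c' < C, then Chebyshev's
    inequality and absolute continuity would make rho {|p| >= c'^n} small;
    integrating - ln |p|, a sum of n kernels, against rho would then give more
    than n V.

    Upper bound. If some r > C satisfied r^n <= sup_E |p| for every monic p of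
    degree n, a greedy choice would give points x_j of E with
    prod_(i < j) |x_j - x_i| >= r^j; a limit of their empirical measures,
    obtained from the quantile functions by Helly's selection theorem, would
    have energy at most - ln r < V.  So some monic p has |p| < r^(deg p) on E.
    Only finitely many points of the support violate this bound; adding them
    as zeros to the powers of p bounds the L^2(mu) minimum. *)

(** * The logarithmic kernel, its nonnegative shift and its truncations *)

Section kernels.
Variable R : realType.
Implicit Types (D d x y : R).

(* On a set of diameter at most D the shift by ln D makes the kernel nonnegative,
   so that the maximum is inactive there and Tonelli's theorem applies. *)
Definition pos_kernel D x y : \bar R := maxe 0%E (logkernel x y + (ln D)%:E)%E.

(** Cutting the distance off below at [d > 0] gives a bounded Lipschitz kernel, which increases to
    [pos_kernel D] as [d] decreases to 0. *)
Definition trunc_kernel D d x y : R :=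
  Num.max 0 (ln D - ln (Num.max `|x - y| d)).

Lemma max_dist_gt0 d x y : 0 < d -> 0 < Num.max `|x - y| d.
Proof. by move=> d0; rewrite lt_max d0 orbT. Qed.

Lemma logkernelC x y : logkernel x y = logkernel y x.
Proof. by rewrite /logkernel eq_sym distrC. Qed.

Lemma pos_kernelC D x y : pos_kernel D x y = pos_kernel D y x.
Proof. by rewrite /pos_kernel logkernelC. Qed.

Lemma pos_kernel_ge0 D x y : (0 <= pos_kernel D x y)%E.
Proof. by rewrite /pos_kernel le_max lexx. Qed.

Lemma pos_kernelxx D x : pos_kernel D x x = +oo%E.
Proof. by rewrite /pos_kernel /logkernel eqxx addye// maxey. Qed.

Lemma pos_kernelE D x y : 0 < `|x - y| <= D ->
  pos_kernel D x y = (ln D - ln `|x - y|)%:E.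
Proof.
move=> /andP[xy0 xyD]; rewrite /pos_kernel /logkernel.
rewrite -subr_eq0 -normr_eq0 gt_eqF// -EFinD addrC; apply/max_idPr.
by rewrite lee_fin subr_ge0 ler_ln// posrE// (lt_le_trans xy0).
Qed.

Lemma pos_kernel_shift D x y : `|x - y| <= D ->
  logkernel x y = (pos_kernel D x y - (ln D)%:E)%E.
Proof.
move=> xyD; have [->|xy] := eqVneq x y.
  by rewrite pos_kernelxx /logkernel eqxx.
rewrite pos_kernelE ?normr_gt0 ?subr_eq0 ?xy// /logkernel (negbTE xy).
by rewrite -EFinD addrAC subrr add0r.
Qed.

Lemma trunc_kernel_ge0 D d x y : 0 <= trunc_kernel D d x y.
Proof. by rewrite /trunc_kernel le_max lexx. Qed.

Lemma trunc_kernel_le_bound D d x y : 0 < d <= D ->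
  trunc_kernel D d x y <= ln D - ln d.
Proof.
move=> /andP[d0 dD]; rewrite ge_max subr_ge0 ler_ln ?posrE ?(lt_le_trans d0)//.
rewrite dD/= lerB// ler_ln ?posrE ?max_dist_gt0//.
by rewrite le_max lexx orbT.
Qed.

Lemma trunc_kernel_le D d x y : 0 < d ->
  ((trunc_kernel D d x y)%:E <= pos_kernel D x y)%E.
Proof.
move=> d0; have [->|xy] := eqVneq x y; first by rewrite pos_kernelxx leey.
have xy0 : 0 < `|x - y| by rewrite normr_gt0 subr_eq0.
rewrite /pos_kernel /logkernel (negbTE xy) -EFinD -EFin_max lee_fin.
rewrite addrC /trunc_kernel ge_max le_max lexx/= le_max lerB ?orbT//.
by rewrite ler_ln ?posrE ?max_dist_gt0// le_max lexx.
Qed.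

Lemma trunc_kernel_nondec D d d' x y : 0 < d' <= d ->
  trunc_kernel D d x y <= trunc_kernel D d' x y.
Proof.
move=> /andP[d0 dd]; rewrite /trunc_kernel ge_max le_max lexx/= le_max.
rewrite lerB ?orbT// ler_ln ?posrE ?max_dist_gt0 ?(lt_le_trans d0)//.
by rewrite ge_max !le_max lexx/= dd orbT.
Qed.

Lemma trunc_kernel_eq D d x y : 0 < d <= `|x - y| ->
  (trunc_kernel D d x y)%:E = pos_kernel D x y.
Proof.
move=> /andP[d0 dxy]; rewrite /trunc_kernel /pos_kernel /logkernel.
have /negbTE -> : x != y by rewrite -subr_eq0 -normr_eq0 gt_eqF// (lt_le_trans d0).
by rewrite (max_idPl dxy) -EFinD -EFin_max addrC.
Qed.

(* On [d, +oo[ the function ln is Lipschitz with constant 1/d. *)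
Lemma trunc_kernel_lip D d x y x' y' : 0 < d ->
  trunc_kernel D d x y <=
  trunc_kernel D d x' y' + d^-1 * (`|x - x'| + `|y - y'|).
Proof.
move=> d0; set e := `|x - x'| + `|y - y'|.
have e0 : 0 <= d^-1 * e by rewrite mulr_ge0 ?invr_ge0 ?(ltW d0)// addr_ge0.
rewrite /trunc_kernel ge_max addr_ge0 ?le_max ?lexx//=.
set u := Num.max `|x - y| d; set v := Num.max `|x' - y'| d.
have u0 : 0 < u by exact: max_dist_gt0.
have v0 : 0 < v by exact: max_dist_gt0.
have du : d <= u by rewrite le_max lexx orbT.
have vu : v <= u + e.
  rewrite ge_max; apply/andP; split; last by rewrite ler_wpDr// addr_ge0.
  have -> : x' - y' = (x - y) + ((x' - x) + (y - y')) by ring.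
  rewrite (le_trans (ler_normD _ _))// lerD ?le_max ?lexx//.
  by rewrite (le_trans (ler_normD _ _))// distrC.
suff : ln v <= ln u + d^-1 * e.
  by move=> ?; rewrite -lerBlDr le_max; apply/orP; right; lra.
have -> : ln v = ln u + ln (v / u).
  by rewrite -lnM ?posrE ?divr_gt0// mulrC divfK// gt_eqF.
rewrite lerD2l.
have -> : v / u = 1 + (v / u - 1) by ring.
rewrite (le_trans (le_ln1Dx _))//; first by rewrite ltrBrDl subrr divr_gt0.
have [vu'|uv] := leP v u.
  by rewrite (le_trans _ e0)// subr_le0 ler_pdivrMr// mul1r.
have -> : v / u - 1 = u^-1 * (v - u) by field; rewrite gt_eqF.
rewrite ler_pM ?invr_ge0 ?(ltW u0) ?subr_ge0 ?(ltW uv)//.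
  by rewrite lef_pV2.
by lra.
Qed.

Lemma cvg_trunc_kernel D x y :
  (trunc_kernel D n.+1%:R^-1 x y)%:E @[n --> \oo] --> pos_kernel D x y.
Proof.
have [->|xy] := eqVneq x y; last first.
  apply: cvg_near_cst; near=> n; apply: trunc_kernel_eq.
  rewrite invr_gt0 ltr0n/= ltW//; near: n.
  by apply: near_infty_natSinv_lt (PosNum _); rewrite normr_gt0 subr_eq0.
(* On the diagonal the truncated kernel is at least [ln D + ln n.+1%:R], which is unbounded. *)
rewrite pos_kernelxx; apply/cvgeyPge => A; near=> n.
rewrite lee_fin le_max; apply/orP; right.
rewrite subrr normr0 (max_idPr _) ?invr_ge0// lnV ?posrE// opprK.
rewrite -lerBlDl -[leLHS]expRK ler_ln ?posrE ?expR_gt0//.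
by rewrite (@le_trans _ _ n%:R) ?ler_nat//; near: n; exact: nbhs_infty_ger.
Unshelve. all: by end_near. Qed.

Lemma measurable_trunc_kernel D d :
  measurable_fun setT (fun z : R * R => trunc_kernel D d z.1 z.2).
Proof.
apply: measurable_maxr => //; apply: measurable_funB => //.
apply: measurableT_comp => //; apply: measurable_maxr => //.
by apply: measurableT_comp => //; apply: measurable_funB.
Qed.

Lemma measurable_pos_kernel D :
  measurable_fun setT (fun z : R * R => pos_kernel D z.1 z.2).
Proof.
apply: (emeasurable_fun_cvg
  (fun n (z : R * R) => (trunc_kernel D n.+1%:R^-1 z.1 z.2)%:E)) => [n|z _].
  by apply/measurable_EFinP; exact: measurable_trunc_kernel.
exact: cvg_trunc_kernel.
Qed.

Lemma measurable_pos_kernel1 D x : measurable_fun setT (pos_kernel D x).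
Proof.
by have := measurable_fun_pair2 x (measurable_pos_kernel D).
Qed.

Lemma measurable_trunc_kernel1 D d x : measurable_fun setT (trunc_kernel D d x).
Proof.
by have := measurable_fun_pair2 x (measurable_trunc_kernel D d).
Qed.

End kernels.

(** * Potentials and energies of the shifted kernel *)

Section energy.
Variable R : realType.
Implicit Types (D d x y c : R) (nu rho : probability R R) (E : set R).

Lemma integral_le_of_cvg (mu : {measure set R -> \bar R}) (A : set R)
    (f_ : (R -> \bar R)^nat) (f : R -> \bar R) (M : \bar R) :
  measurable A ->
  (forall n, measurable_fun A (f_ n)) -> (forall n x, A x -> (0 <= f_ n x)%E) ->
  (forall x, A x -> {homo f_^~ x : n m / (n <= m)%N >-> (n <= m)%E}) ->
  (forall x, A x -> f_ n x @[n --> \oo] --> f x) ->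
  (forall n, (\int[mu]_(x in A) f_ n x <= M)%E) ->
  (\int[mu]_(x in A) f x <= M)%E.
Proof.
move=> mA mf f0 ndf ff fM.
rewrite (eq_integral (fun x => limn (f_^~ x))); last first.
  by move=> x /set_mem Ax; apply/esym/cvg_lim => //; exact: ff.
have /cvg_lim <- // := @cvg_monotone_convergence _ _ _ mu _ mA _ mf f0 ndf.
apply: lime_le; last exact: nearW.
apply: ereal_nondecreasing_is_cvgn => m n mn.
by apply: ge0_le_integral => // [x Ax|x Ax]; [exact: f0|exact: ndf].
Qed.

Lemma integral_cst_prob nu (r : \bar R) : (\int[nu]_x r = r)%E.
Proof.
rewrite -[RHS]mule1 integral_cst//; congr (_ * _)%E; exact: probability_setT.
Qed.

(** Since [f] is nonnegative, the negative part of [f - c] is at most [c] and has a finite integral;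
    no difference of infinities arises, even if the integral of [f] is infinite. *)
Lemma integral_subr_cst nu (f : R -> \bar R) c : 0 <= c ->
  measurable_fun setT f -> (forall x, 0 <= f x)%E ->
  (\int[nu]_x (f x - c%:E) = \int[nu]_x f x - c%:E)%E.
Proof.
move=> c0 mf f0; set g := fun x => (f x - c%:E)%E.
have mg : measurable_fun setT g.
  by rewrite /g; apply: emeasurable_funB.
have H : (\int[nu]_x g^\+ x + c%:E = \int[nu]_x f x + \int[nu]_x g^\- x)%E.
  rewrite -{1}(integral_cst_prob nu c%:E) -!ge0_integralD//; last 2 first.
  - exact: measurable_funeneg.
  - exact: measurable_funepos.
  apply: eq_integral => x _; rewrite /g funeposE funenegE.
  case: (f x) (f0 x) => [r| |]//=; last by rewrite !addye ?maxye ?maxNye ?addye.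
  rewrite lee_fin => r0; rewrite -!EFin_max -!EFinD.
  by congr EFin; rewrite /Num.max; case: (ltP (r - c)) => ?; case: ltP => ?; lra.
rewrite integralE.
have : (\int[nu]_x g^\- x <= c%:E)%E.
  rewrite -(integral_cst_prob nu c%:E); apply: ge0_le_integral => //.
    exact: measurable_funeneg.
  move=> x _; rewrite funenegE ge_max lee_fin c0 andbT /g.
  case: (f x) (f0 x) => [r| |]//=; last by rewrite leNye.
  by rewrite lee_fin => r0; rewrite lee_fin; lra.
have : (0 <= \int[nu]_x g^\- x)%E by apply: integral_ge0.
have : (0 <= \int[nu]_x g^\+ x)%E by apply: integral_ge0.
have : (0 <= \int[nu]_x f x)%E by apply: integral_ge0.
move: H.
case: (\int[nu]_x g^\- x)%E => [u| |]//; case: (\int[nu]_x g^\+ x)%E => [v| |]//;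
  case: (\int[nu]_x f x)%E => [w| |]//.
by rewrite -!EFinD => -[vw] _ _ _ _; congr EFin; lra.
Qed.

Definition potential D (nu : set R -> \bar R) x : \bar R :=
  (\int[nu]_y pos_kernel D x y)%E.

Definition energy D (nu : set R -> \bar R) : \bar R :=
  (\int[nu]_x potential D nu x)%E.

Lemma potential_ge0 D (nu : {measure set R -> \bar R}) x :
  (0 <= potential D nu x)%E.
Proof. by apply: integral_ge0 => y _; exact: pos_kernel_ge0. Qed.

Lemma energy_ge0 D (nu : {measure set R -> \bar R}) : (0 <= energy D nu)%E.
Proof. by apply: integral_ge0 => y _; exact: potential_ge0. Qed.

Lemma measurable_potential D (nu : {sigma_finite_measure set R -> \bar R}) :
  measurable_fun setT (potential D nu).
Proof.
apply: (@measurable_fun_fubini_tonelli_F _ _ _ _ R nu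
  (fun z : R * R => pos_kernel D z.1 z.2) (measurable_pos_kernel D)).
by move=> z; exact: pos_kernel_ge0.
Qed.

Lemma measurable_logkernel :
  measurable_fun setT (fun z : R * R => logkernel z.1 z.2).
Proof.
apply: measurable_fun_ifT => //; first exact: measurable_fun_eqr.
apply/measurable_EFinP/measurable_funN; apply: measurableT_comp => //.
by apply: measurableT_comp => //; exact: measurable_funB.
Qed.

(** The kernel changes sign, so Tonelli's theorem is applied to its positive and negative parts
    separately. *)
Lemma measurable_int_logkernel nu :
  measurable_fun setT (fun x => (\int[nu]_y logkernel x y)%E).
Proof.
have mk := measurable_logkernel.
rewrite [X in measurable_fun _ X](_ : _ = fun x =>
  (\int[nu]_y maxe (logkernel x y) 0 -
   \int[nu]_y maxe (- logkernel x y) 0)%E); last first.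
  apply/funext => x; rewrite integralE; congr (_ - _)%E.
    by apply: eq_integral => y _; rewrite funeposE.
  by apply: eq_integral => y _; rewrite funenegE.
apply: emeasurable_funB.
- apply: (@measurable_fun_fubini_tonelli_F _ _ _ _ R nu
    (fun z : R * R => maxe (logkernel z.1 z.2) 0%E)).
    exact: measurable_maxe.
  by move=> z; rewrite le_max lexx orbT.
- apply: (@measurable_fun_fubini_tonelli_F _ _ _ _ R nu
    (fun z : R * R => maxe (- logkernel z.1 z.2) 0)%E).
    by apply: measurable_maxe => //; exact: measurableT_comp.
  by move=> z; rewrite le_max lexx orbT.
Qed.

Lemma ae_prob_on nu E (P : R -> Prop) : measurable E -> prob_on E nu ->
  (forall x, E x -> P x) -> {ae nu, forall x, setT x -> P x}.
Proof.
move=> mE nuE EP; exists (~` E); split => //; first exact: measurableC.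
by move=> x /= nP Ex; apply: nP => _; exact: EP.
Qed.

(** Points of [E] are at distance at most [D], so the shift is exact there, and a probability
    measure integrates the constant [ln D] to itself. The condition [1 <= D] makes this constant
    nonnegative. *)
Lemma log_energyE D nu E : 1 <= D -> measurable E -> prob_on E nu ->
  (forall x y, E x -> E y -> `|x - y| <= D) ->
  log_energy nu = (energy D nu - (ln D)%:E)%E.
Proof.
move=> D1 mE nuE ED; rewrite /log_energy.
rewrite (ae_eq_integral (fun x => (potential D nu x - (ln D)%:E)%E))//.
- rewrite integral_subr_cst// ?ln_ge0//; first exact: measurable_potential.
  by move=> x; exact: potential_ge0.
- exact: measurable_int_logkernel.
- by apply: emeasurable_funB => //; exact: measurable_potential.
apply: (ae_prob_on mE nuE) => x Ex.
rewrite (ae_eq_integral (fun y => (pos_kernel D x y - (ln D)%:E)%E))//.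
- rewrite integral_subr_cst ?ln_ge0//; first exact: measurable_pos_kernel1.
  by move=> y; exact: pos_kernel_ge0.
- exact: measurable_fun_pair2 measurable_logkernel.
- by apply: emeasurable_funB => //; exact: measurable_pos_kernel1.
by apply: (ae_prob_on mE nuE) => y Ey; rewrite (@pos_kernel_shift _ D)// ED.
Qed.

Lemma robin_energy_le D nu rho E : 1 <= D -> measurable E ->
  (forall x y, E x -> E y -> `|x - y| <= D) ->
  equilibrium_measure E rho -> prob_on E nu -> (energy D rho <= energy D nu)%E.
Proof.
move=> D1 mE ED [rhoE rhoV] nuE.
have : (log_energy rho <= log_energy nu)%E.
  by rewrite rhoV; apply: ereal_inf_lbound; exists nu.
by rewrite (log_energyE D1 mE rhoE ED) (log_energyE D1 mE nuE ED) leeD2rE.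
Qed.

End energy.

(** * First variation of the energy at its minimiser *)

Section frostman.
Variable R : realType.
Implicit Types (D d x y c v : R) (nu rho : probability R R) (A B E : set R).

(** The perturbation of the variational argument: [rho] is multiplied by [1 - t] on [B], kept off
    [B] and then normalised, [c] being the total mass. *)
Lemma exists_reweighted_prob rho B (t : R) : measurable B ->
  0 < t < 1 -> exists nu : probability R R,
  let c := 1 - t * fine (rho B) in
  [/\ forall U, measurable U -> U `<=` B -> nu U = (((1 - t) / c)%:E * rho U)%E &
      forall U, measurable U -> U `<=` ~` B -> nu U = ((c^-1)%:E * rho U)%E].
Proof.
move=> mB /andP[t0 t1].
have mB' := measurableC mB.
have u0 : 0 <= 1 - t by rewrite subr_ge0 ltW.
pose m : {measure set R -> \bar R} :=
  measure_add (mscale (NngNum u0) (mrestr rho mB)) (mrestr rho mB').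
have mE U : m U = ((1 - t)%:E * rho (U `&` B) + rho (U `&` ~` B))%E.
  by rewrite /= /measure_add /msum 2!big_ord_recl/= big_ord0 adde0.
have bfin : rho B = (fine (rho B))%:E by rewrite fineK// fin_num_measure.
have b1 : fine (rho B) <= 1 by rewrite -lee_fin -bfin; exact: probability_le1.
have mT : m setT = (1 - t * fine (rho B))%:E.
  rewrite mE !setTI probability_setC// bfin -EFinB -EFinM -EFinD.
  by congr EFin; rewrite /=; ring.
exists (mnormalize m rho : probability R R) => /=.
set c := 1 - _ in mT *.
have c0 : 0 < c.
  rewrite subr_gt0 (le_lt_trans _ t1)// ler_piMr// ltW//.
have nE U : mnormalize m rho U = (m U * (c^-1)%:E)%E.
  by rewrite /mnormalize mT /= eqe gt_eqF.
split=> U mU UB; rewrite nE mE.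
- rewrite (setIidl UB) [X in (_ + rho X)%E](_ : _ = set0).
    by rewrite measure0 adde0 muleC muleA -EFinM mulrC.
  by apply/seteqP; split => // x [/UB].
- rewrite (setIidl UB) [X in (_ * rho X + _)%E](_ : _ = set0).
    by rewrite measure0 mule0 add0e muleC.
  by apply/seteqP; split => // x [/UB].
Qed.

Lemma integral_reweighted rho nu B (p q : {nonneg R}) (f : R -> \bar R) :
  measurable B -> measurable_fun setT f -> (forall x, 0 <= f x)%E ->
  (forall U, measurable U -> U `<=` B -> nu U = (p%:num%:E * rho U)%E) ->
  (forall U, measurable U -> U `<=` ~` B -> nu U = (q%:num%:E * rho U)%E) ->
  (\int[nu]_x f x = p%:num%:E * \int[rho]_(x in B) f x
    + q%:num%:E * \int[rho]_(x in ~` B) f x)%E.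
Proof.
move=> mB mf f0 nuB nuB'; have mB' := measurableC mB.
rewrite -[X in (\int[nu]_(x in X) _)%E](setUv B) ge0_integral_setU//; last 2 first.
- exact: measurable_funTS.
- exact/disj_setPCl.
congr (_ + _)%E.
- rewrite -ge0_integral_mscale//; last exact: measurable_funTS.
  exact: eq_measure_integral.
- rewrite -ge0_integral_mscale//; last exact: measurable_funTS.
  exact: eq_measure_integral.
Qed.

Lemma measurable_indic_fst A : measurable A ->
  measurable_fun setT (fun z : R * R => \1_A z.1 : R).
Proof.
move=> mA; rewrite [X in measurable_fun _ X](_ : _ = \1_(A `*` setT)).
  by apply: measurable_indic; exact: measurableX.
apply/funext => z; rewrite !indicE; congr (_%:R); congr nat_of_bool.
by apply/idP/idP => [/set_mem ?|/set_mem[? _]]; apply/mem_set.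
Qed.

Lemma measurable_indic_snd A : measurable A ->
  measurable_fun setT (fun z : R * R => \1_A z.2 : R).
Proof.
move=> mA; rewrite [X in measurable_fun _ X](_ : _ = \1_(setT `*` A)).
  by apply: measurable_indic; exact: measurableX.
apply/funext => z; rewrite !indicE; congr (_%:R); congr nat_of_bool.
by apply/idP/idP => [/set_mem ?|/set_mem[_ ?]]; apply/mem_set.
Qed.

Definition mutual_energy D rho A B : \bar R :=
  (\int[rho]_(x in A) \int[rho]_(y in B) pos_kernel D x y)%E.

Lemma mutual_energy_ge0 D rho A B : (0 <= mutual_energy D rho A B)%E.
Proof.
by apply: integral_ge0 => x _; apply: integral_ge0 => y _; exact: pos_kernel_ge0.
Qed.

(** Tonelli's theorem for a symmetric kernel, once indicator functions have turned both domains into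
    the whole line. *)
Lemma mutual_energyC D rho A B : measurable A -> measurable B ->
  mutual_energy D rho A B = mutual_energy D rho B A.
Proof.
move=> mA mB; rewrite /mutual_energy.
have H A' B' : measurable A' -> measurable B' ->
  (\int[rho]_(x in A') \int[rho]_(y in B') pos_kernel D x y =
   \int[rho]_x \int[rho]_y (pos_kernel D x y * ((\1_A' x)%:E * (\1_B' y)%:E)))%E.
  move=> mA' mB'; rewrite integral_mkcond; apply: eq_integral => x _.
  rewrite patchE; case: ifPn => xA; last first.
    rewrite integral0_eq// => y _.
    by rewrite indicE (negbTE xA) mul0e mule0.
  rewrite integral_mkcond; apply: eq_integral => y _.
  rewrite patchE !indicE xA mul1e.
  by case: ifPn => yB; rewrite ?mule1 ?mule0.
rewrite [LHS](H _ _ mA mB) [RHS](H _ _ mB mA).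
pose g (z : R * R) :=
  (pos_kernel D z.1 z.2 * ((\1_A z.1)%:E * (\1_B z.2)%:E))%E.
have mg : measurable_fun setT g.
  apply: emeasurable_funM; first exact: measurable_pos_kernel.
  apply: emeasurable_funM; apply/measurable_EFinP.
    exact: measurable_indic_fst.
  exact: measurable_indic_snd.
have g0 z : (0 <= g z)%E.
  by rewrite mule_ge0 ?pos_kernel_ge0// mule_ge0// lee_fin.
apply: etrans (fubini_tonelli (m1 := rho) (m2 := rho) g mg g0) _.
apply: eq_integral => x _; apply: eq_integral => y _.
by rewrite /g/= pos_kernelC [in RHS](muleC (\1_B x)%:E).
Qed.

Lemma measurable_partial_potential D rho B : measurable B ->
  measurable_fun setT (fun x => (\int[rho]_(y in B) pos_kernel D x y)%E).
Proof.
move=> mB.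
rewrite [X in measurable_fun _ X](_ : _ = fun x =>
  (\int[rho]_y (pos_kernel D x y * (\1_B y)%:E))%E); last first.
  apply/funext => x; rewrite integral_mkcond; apply: eq_integral => y _.
  by rewrite patchE indicE; case: ifPn => yB; rewrite ?mule1 ?mule0.
apply: (@measurable_fun_fubini_tonelli_F _ _ _ _ R rho
  (fun z : R * R => pos_kernel D z.1 z.2 * (\1_B z.2)%:E)%E).
  apply: emeasurable_funM; first exact: measurable_pos_kernel.
  by apply/measurable_EFinP; exact: measurable_indic_snd.
by move=> z; rewrite mule_ge0 ?pos_kernel_ge0// lee_fin.
Qed.

Lemma partial_potential_ge0 D rho B x :
  (0 <= \int[rho]_(y in B) pos_kernel D x y)%E.
Proof. by apply: integral_ge0 => y _; exact: pos_kernel_ge0. Qed.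

Lemma integral_potential D rho A B : measurable A -> measurable B ->
  (\int[rho]_(x in A) potential D rho x =
   mutual_energy D rho A B + mutual_energy D rho A (~` B))%E.
Proof.
move=> mA mB; have mB' := measurableC mB.
rewrite -ge0_integralD//.
- apply: eq_integral => x _; rewrite /potential.
  rewrite -[X in (\int[rho]_(x in X) _ = _)%E](setUv B) ge0_integral_setU//.
  + by apply: measurable_funTS; exact: measurable_pos_kernel1.
  + by move=> y _; exact: pos_kernel_ge0.
  + exact/disj_setPCl.
- by move=> x _; exact: partial_potential_ge0.
- by apply: measurable_funTS; exact: measurable_partial_potential.
- by move=> x _; exact: partial_potential_ge0.
- by apply: measurable_funTS; exact: measurable_partial_potential.
Qed.

Lemma energy_split D rho B : measurable B ->
  energy D rho = (mutual_energy D rho B B + mutual_energy D rho B (~` B) +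
    (mutual_energy D rho B (~` B) + mutual_energy D rho (~` B) (~` B)))%E.
Proof.
move=> mB; have mB' := measurableC mB.
rewrite /energy -[X in (\int[rho]_(x in X) _ = _)%E](setUv B).
rewrite ge0_integral_setU//; last 3 first.
- exact: measurable_funTS (measurable_potential _ _).
- by move=> y _; exact: potential_ge0.
- exact/disj_setPCl.
congr (_ + _)%E; first exact: integral_potential.
by rewrite -(mutual_energyC D rho mB' mB); exact: integral_potential.
Qed.

(** The energy is a quadratic form in the two weights, whose coefficients are the mutual energies of
    [B] and its complement under [rho]. *)
Lemma energy_reweighted D rho nu B (p q : {nonneg R}) : measurable B ->
  (forall U, measurable U -> U `<=` B -> nu U = (p%:num%:E * rho U)%E) ->
  (forall U, measurable U -> U `<=` ~` B -> nu U = (q%:num%:E * rho U)%E) ->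
  energy D nu = (p%:num%:E * (p%:num%:E * mutual_energy D rho B B +
      q%:num%:E * mutual_energy D rho B (~` B)) +
    q%:num%:E * (p%:num%:E * mutual_energy D rho B (~` B) +
      q%:num%:E * mutual_energy D rho (~` B) (~` B)))%E.
Proof.
move=> mB nuB nuB'; have mB' := measurableC mB.
have mpot Y X : measurable Y -> measurable_fun X
    (fun x => (\int[rho]_(y in Y) pos_kernel D x y)%E).
  by move=> mY; apply: measurable_funTS; exact: measurable_partial_potential.
have Jnu X : measurable X -> (\int[rho]_(x in X) potential D nu x =
    p%:num%:E * mutual_energy D rho X B +
    q%:num%:E * mutual_energy D rho X (~` B))%E.
  move=> mX; rewrite /mutual_energy -!ge0_integralZl//; last 4 first.
  - exact: mpot.
  - by move=> x _; exact: partial_potential_ge0.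
  - exact: mpot.
  - by move=> x _; exact: partial_potential_ge0.
  rewrite -ge0_integralD//.
  - apply: eq_integral => x _; rewrite /potential.
    apply: (integral_reweighted mB) => //; first exact: measurable_pos_kernel1.
    by move=> y; exact: pos_kernel_ge0.
  - by move=> x _; rewrite mule_ge0// partial_potential_ge0.
  - by apply: measurable_funeM; exact: mpot.
  - by move=> x _; rewrite mule_ge0// partial_potential_ge0.
  - by apply: measurable_funeM; exact: mpot.
rewrite {1}/energy (integral_reweighted mB _ _ nuB nuB'); last 2 first.
- exact: measurable_potential.
- by move=> x; exact: potential_ge0.
by rewrite (Jnu _ mB) (Jnu _ mB') [mutual_energy D rho (~` B) B]mutual_energyC.
Qed.

(* Moving mass away from the set where the potential exceeds the energy would
   decrease the energy to first order. *)
Lemma potential_le_ae D rho E v : energy D rho = v%:E -> prob_on E rho ->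
  measurable E ->
  (forall nu, prob_on E nu -> (energy D rho <= energy D nu)%E) ->
  forall e, 0 < e -> rho [set x | ((v + e)%:E < potential D rho x)%E] = 0%E.
Proof.
move=> rhov rhoE mE min e e0; set B := [set x | _].
have mW := measurable_potential D rho.
have mB : measurable B.
  by rewrite -[B]setTI; exact: emeasurable_fun_o_infty.
have mB' := measurableC mB.
have bfin : rho B = (fine (rho B))%:E by rewrite fineK// fin_num_measure.
set b := fine (rho B) in bfin.
have b1 : b <= 1 by rewrite -lee_fin -bfin; exact: probability_le1.
have b0 : 0 <= b by exact: fine_ge0.
apply/eqP/negPn/negP => rB0.
have {rB0}b_gt0 : 0 < b by rewrite lt_def b0 andbT -eqe -bfin.
have energyE := energy_split D rho mB.
(* Finite energy makes all mutual energies finite, so the comparison takes place among real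
   numbers. *)
have : energy D rho \is a fin_num by rewrite rhov.
rewrite energyE fin_numD => /andP[].
rewrite fin_numD => /andP[pf qf]; rewrite fin_numD => /andP[_ rf].
set p := fine (mutual_energy D rho B B).
set q := fine (mutual_energy D rho B (~` B)).
set r := fine (mutual_energy D rho (~` B) (~` B)).
have pE : mutual_energy D rho B B = p%:E by rewrite fineK.
have qE : mutual_energy D rho B (~` B) = q%:E by rewrite fineK.
have rE : mutual_energy D rho (~` B) (~` B) = r%:E by rewrite fineK.
have pqr : v = p + q + (q + r).
  by move: energyE; rewrite rhov pE qE rE -!EFinD => -[].
have v0 : 0 <= v by rewrite -lee_fin -rhov energy_ge0.
have p0 : 0 <= p by rewrite -lee_fin -pE mutual_energy_ge0.
(* The inequality defining [B] is integrated over [B]; [p + q] is the integral of the potential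
   there. *)
have vb : (v + e) * b <= p + q.
  rewrite -lee_fin EFinD -pE -qE -integral_potential// EFinM -bfin.
  rewrite -integral_cst//; apply: ge0_le_integral => //.
  - by move=> x _; rewrite lee_fin addr_ge0// ltW.
  - exact: measurable_funTS.
  - by move=> x /ltW.
(* Minimality gives [v * c ^+ 2 <= (1 - t) ^+ 2 * p + 2 * (1 - t) * q + r]. With [v = p + 2 * q + r]
   and [c = 1 - t * b] this implies [2 * t * (p + q - v * b) <= t ^+ 2 * p], where [p + q - v * b]
   is at least [e * b]. *)
have key t : 0 < t < 1 -> 2 * e * b <= t * p.
  move=> t01; have /andP[t0 t1] := t01.
  have [nu /=] := exists_reweighted_prob rho mB t01.
  rewrite -/b; set c := 1 - t * b => -[nuB nuB'].
  have c0 : 0 < c.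
    by rewrite subr_gt0 (le_lt_trans _ t1)// ler_piMr// ltW.
  have pp : 0 <= (1 - t) / c by apply: divr_ge0; [rewrite subr_ge0 ltW|exact: ltW].
  have qq : 0 <= c^-1 by rewrite invr_ge0 ltW.
  have nuE : prob_on E nu.
    have mE' := measurableC mE.
    have m1 : measurable (~` E `&` B) by exact: measurableI.
    have m2 : measurable (~` E `&` ~` B) by exact: measurableI.
    have n1 : nu (~` E `&` B) = 0%E.
      by rewrite (nuB _ m1 (@subIsetr _ _ _))
        (subset_measure0 m1 mE' (@subIsetl _ _ _) rhoE) mule0.
    have n2 : nu (~` E `&` ~` B) = 0%E.
      by rewrite (nuB' _ m2 (@subIsetr _ _ _))
        (subset_measure0 m2 mE' (@subIsetl _ _ _) rhoE) mule0.
    rewrite /prob_on -[~` E]setIT -(setUv B) setIUr.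
    apply: etrans (measureU _ m1 m2 _) _; first by rewrite setIACA setICr setI0.
    rewrite -[RHS]adde0; congr (_ + _)%E; [exact: n1|exact: n2].
  have := min _ nuE; rewrite rhov.
  rewrite (energy_reweighted D (p := NngNum pp) (q := NngNum qq) mB nuB nuB').
  rewrite pE qE rE lee_fin /= => H.
  have : v * c ^+ 2 <= (1 - t) ^+ 2 * p + 2 * (1 - t) * q + r.
    rewrite -ler_pdivlMr ?exprn_gt0// (le_trans H)// le_eqVlt; apply/orP; left.
    by apply/eqP; field; rewrite gt_eqF.
  rewrite pqr /c => H2.
  rewrite -(ler_pM2l t0).
  have : 0 <= v * (t * b) ^+ 2 by rewrite mulr_ge0// sqr_ge0.
  have : t * ((v + e) * b) <= t * (p + q) by rewrite ler_wpM2l// ltW.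
  rewrite pqr => ? ?; nra.
(* The second bound makes [t * p] at most [e * b], against [key]; adding 1 keeps the denominator
   positive, and the first bound keeps [t] below 1. *)
pose t := Num.min (1 / 2) (e * b / (p + 1)).
have eb : 0 < e * b by rewrite mulr_gt0.
have t0 : 0 < t by rewrite lt_min; rewrite !divr_gt0// ltr_wpDl.
have t1 : t < 1 by rewrite gt_min; apply/orP; left; lra.
have := key t; rewrite t0 t1 => /(_ isT).
have : t * (p + 1) <= e * b.
  by rewrite -ler_pdivlMr ?ltr_wpDl// ge_min lexx orbT.
move=> teb key_t; have : 2 * (e * b) <= e * b.
  rewrite mulrA (le_trans key_t)// (le_trans _ teb)// ler_wpM2l// ?(ltW t0)//.
  by rewrite lerDl.
by rewrite ger_pMl// leNgt ltr1n.
Qed.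

End frostman.

(** * Maximum principle for the potential on the line *)

Section maximum_principle.
Variable R : realType.
Implicit Types (D d x y z v : R) (rho : probability R R) (S : set R).

(** The truncated potentials are Lipschitz and increase to the potential, so a bound at points
    arbitrarily near [x] passes to each truncation at [x] and then to the limit. *)
Lemma potential_lsc D rho x (v : R) :
  (forall e, 0 < e -> exists x', `|x - x'| < e /\ (potential D rho x' <= v%:E)%E) ->
  (potential D rho x <= v%:E)%E.
Proof.
move=> H; apply: (@integral_le_of_cvg _ _ _
  (fun n y => (trunc_kernel D n.+1%:R^-1 x y)%:E)) => //.
- by move=> n; apply/measurable_EFinP; exact: measurable_trunc_kernel1.
- by move=> n y _; rewrite lee_fin trunc_kernel_ge0.
- move=> y _ m n mn; rewrite lee_fin trunc_kernel_nondec// invr_gt0 ltr0n/=.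
  by rewrite lef_pV2 ?posrE// ler_nat.
- by move=> y _; exact: cvg_trunc_kernel.
move=> n; apply/lee_addgt0Pr => e e0.
have d0 : 0 < n.+1%:R^-1 :> R by rewrite invr_gt0.
(* The truncation has Lipschitz constant [n.+1%:R], so a shift by this distance costs at most
   [e]. *)
have [x' [xx' x'v]] := H (n.+1%:R^-1 * e) (mulr_gt0 d0 e0).
apply: le_trans (leeD x'v (lexx _)).
have -> : (potential D rho x' + e%:E = \int[rho]_y (pos_kernel D x' y + e%:E))%E.
  rewrite ge0_integralD//.
  - by rewrite integral_cst_prob.
  - by move=> y _; exact: pos_kernel_ge0.
  - exact: measurable_pos_kernel1.
  - by move=> y _; rewrite lee_fin ltW.
apply: ge0_le_integral => //.
- by move=> y _; rewrite lee_fin trunc_kernel_ge0.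
- by apply/measurable_EFinP; exact: measurable_trunc_kernel1.
- by apply: emeasurable_funD => //; exact: measurable_pos_kernel1.
move=> y _; apply: le_trans (leeD (trunc_kernel_le D x' y d0) (lexx _)).
rewrite -EFinD lee_fin (le_trans (trunc_kernel_lip D x y x' y d0))//.
rewrite lerD2l subrr normr0 addr0 invrK -ler_pdivlMl ?ltr0n//.
exact: ltW.
Qed.

Lemma ln_le_tangent (u w : R) : 0 < u -> 0 < w -> ln u <= ln w + (u / w - 1).
Proof.
move=> u0 w0; have -> : ln u = ln w + ln (1 + (u / w - 1)).
  rewrite [1 + _]addrC subrK -lnM ?posrE ?divr_gt0//.
  by rewrite mulrC divfK// gt_eqF.
by rewrite lerD2l le_ln1Dx// ltrBrDl subrr divr_gt0.
Qed.

Lemma pos_kernel_mono D x y z : 0 < `|y - x| <= `|z - x| -> `|z - x| <= D ->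
  (pos_kernel D z x <= pos_kernel D y x)%E.
Proof.
move=> /andP[yx0 yz] zD; have zx0 := lt_le_trans yx0 yz.
rewrite !pos_kernelE ?yx0 ?zx0 ?(le_trans yz)// lee_fin lerB//.
by rewrite ler_ln ?posrE.
Qed.

(** As [y] does not lie strictly between [x1] and [x2], the distance to [y] is affine between them,
    and [- ln] is convex. If [y] is one of the two points, the right side is infinite. *)
Lemma pos_kernel_convex D x1 x2 p q z y : 0 < p -> 0 < q -> p + q = 1 ->
  z = p * x1 + q * x2 -> 0 <= (x1 - y) * (x2 - y) ->
  `|x1 - y| <= D -> `|x2 - y| <= D -> 0 < `|z - y| <= D ->
  (pos_kernel D z y <= p%:E * pos_kernel D x1 y + q%:E * pos_kernel D x2 y)%E.
Proof.
move=> p0 q0 pq zE side x1D x2D zD.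
have [->|x1y] := eqVneq x1 y.
  rewrite pos_kernelxx gt0_muley ?lte_fin// addye ?leey//.
  have := pos_kernel_ge0 D x2 y; case: (pos_kernel D x2 y) => //= _.
  by rewrite gt0_muley ?lte_fin.
have [->|x2y] := eqVneq x2 y.
  rewrite pos_kernelxx [X in (_ + X)%E]gt0_muley ?lte_fin// addey ?leey//.
  have := pos_kernel_ge0 D x1 y; case: (pos_kernel D x1 y) => //= _.
  by rewrite gt0_muley ?lte_fin.
have x1y0 : 0 < `|x1 - y| by rewrite normr_gt0 subr_eq0.
have x2y0 : 0 < `|x2 - y| by rewrite normr_gt0 subr_eq0.
have /andP[z0 _] := zD.
rewrite !pos_kernelE ?x1y0 ?x2y0// -!EFinM -EFinD lee_fin.
have H1 := ln_le_tangent x1y0 z0; have H2 := ln_le_tangent x2y0 z0.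
have wE : p * `|x1 - y| + q * `|x2 - y| = `|z - y|.
  have zyE : z - y = p * (x1 - y) + q * (x2 - y).
    by rewrite zE -[in LHS](mul1r y) -pq; ring.
  have [x1s|x1s] := leP 0 (x1 - y).
    have x2s : 0 <= x2 - y.
      by rewrite -(@pmulr_rge0 _ (x1 - y))// lt_def subr_eq0 x1y.
    by rewrite !ger0_norm// zyE addr_ge0// mulr_ge0// ltW.
  have x2s : x2 - y <= 0 by rewrite -(@nmulr_rge0 _ (x1 - y)).
  rewrite (ltr0_norm x1s) (ler0_norm x2s) ler0_norm; first by rewrite zyE; ring.
  by rewrite zyE -oppr_ge0 opprD addr_ge0// -mulrN mulr_ge0 ?oppr_ge0// ltW.
have : p * ln `|x1 - y| + q * ln `|x2 - y| <= ln `|z - y|.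
  have : p * (`|x1 - y| / `|z - y|) + q * (`|x2 - y| / `|z - y|) = 1.
    by rewrite !mulrA -mulrDl wE divff// gt_eqF.
  have := ler_wpM2l (ltW p0) H1; have := ler_wpM2l (ltW q0) H2.
  have -> : q = 1 - p by rewrite -pq; ring.
  by move=> *; nra.
have -> : q = 1 - p by rewrite -pq; ring.
by move=> *; nra.
Qed.

(** Integrates a kernel inequality over a set that carries [rho]. It serves for a gap with points of
    [S] on both sides and, with [q = 0], for a point with all of [S] on one side. *)
Lemma potential_le_comb D rho S x1 x2 (p q v : R) z : measurable S ->
  rho (~` S) = 0%E -> 0 <= p -> 0 <= q -> p + q = 1 ->
  (forall y, S y ->
    (pos_kernel D z y <= p%:E * pos_kernel D x1 y + q%:E * pos_kernel D x2 y)%E) ->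
  (potential D rho x1 <= v%:E)%E -> (potential D rho x2 <= v%:E)%E ->
  (potential D rho z <= v%:E)%E.
Proof.
move=> mS rhoS p0 q0 pq H x1v x2v.
have mk x := measurable_pos_kernel1 D x.
apply: (@le_trans _ _ (p%:E * potential D rho x1 + q%:E * potential D rho x2)%E).
  have kx x : [set: R] x -> (0 <= p%:E * pos_kernel D x1 x)%E.
    by rewrite mule_ge0// pos_kernel_ge0.
  have kx' x : [set: R] x -> (0 <= q%:E * pos_kernel D x2 x)%E.
    by rewrite mule_ge0// pos_kernel_ge0.
  rewrite /potential -!ge0_integralZl//; last 2 first.
  - by move=> y _; exact: pos_kernel_ge0.
  - by move=> y _; exact: pos_kernel_ge0.
  rewrite -ge0_integralD//; try exact: measurable_funeM.
  apply: ae_ge0_le_integral => //.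
  - by move=> y _; exact: pos_kernel_ge0.
  - by move=> y _; rewrite adde_ge0 ?kx ?kx'.
  - by apply: emeasurable_funD; exact: measurable_funeM.
  exact: (ae_prob_on mS rhoS).
apply: (@le_trans _ _ (p%:E * v%:E + q%:E * v%:E)%E).
  by apply: leeD; apply: lee_wpmul2l => //; rewrite lee_fin.
by rewrite -!EFinM -EFinD -mulrDl pq mul1r.
Qed.

(* In a gap of the closed set S where the potential is at most v, the potential
   is a mixture of the functions - ln |z - y|, convex on the gap. *)
Lemma potential_le_everywhere D rho E a b v :
  measurable E -> prob_on E rho -> E `<=` `[a, b] -> b - a <= D ->
  (forall e, 0 < e -> rho [set x | ((v + e)%:E < potential D rho x)%E] = 0%E) ->
  forall z, a <= z <= b -> (potential D rho z <= v%:E)%E.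
Proof.
move=> mE rhoE Eab abD rhov z /andP[az zb].
have mW := measurable_potential D rho.
(* [S] carries [rho]: its complement lies in the union of the complement of [E] and the null sets
   where the potential exceeds [v + n.+1%:R^-1]. *)
pose S := [set x | E x /\ (potential D rho x <= v%:E)%E].
have mS : measurable S.
  apply: measurableI => //; rewrite -[X in measurable X]setTI.
  exact: emeasurable_fun_infty_c.
have rhoS : rho (~` S) = 0%E.
  apply/eqP; rewrite -measure_le0; apply: (@le_trans _ _
    (rho (~` E `|` \bigcup_n [set x | ((v + n.+1%:R^-1)%:E < potential D rho x)%E]))).
    have mB n : measurable [set x | ((v + n.+1%:R^-1)%:E < potential D rho x)%E].
      by rewrite -[X in measurable X]setTI; exact: emeasurable_fun_o_infty.
    apply: le_measure; rewrite ?inE.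
    - exact: measurableC.
    - by apply: measurableU; [exact: measurableC|exact: bigcup_measurable].
    move=> x /= nS; have [Ex|] := pselect (E x); [right|by left].
    have /negP : ~ (potential D rho x <= v%:E)%E by move=> ?; apply: nS.
    rewrite -ltNge; case xr : (potential D rho x) (potential_ge0 D rho x) => [r| |]// _.
      rewrite lte_fin -subr_gt0 => rv.
      have [n _ /(_ n (leqnn _)) rn] := near_infty_natSinv_lt (PosNum rv).
      by exists n => //=; rewrite xr lte_fin -ltrBrDl.
    by move=> _; exists 0%N => //=; rewrite xr ltry.
  rewrite measureU0//; last 3 first.
  - exact: measurableC.
  - apply: bigcup_measurable => n _; rewrite -[X in measurable X]setTI.
    exact: emeasurable_fun_o_infty.
  - apply/eqP; rewrite -measure_le0.
    apply: (le_trans (measure_sigma_subadditive _ _ _ (@subset_refl _ _))) => //.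
    + by move=> n; rewrite -[X in measurable X]setTI; exact: emeasurable_fun_o_infty.
    + apply: bigcup_measurable => n _; rewrite -[X in measurable X]setTI.
      exact: emeasurable_fun_o_infty.
    by rewrite eseries0// => n _ _; apply: rhov; rewrite invr_gt0.
  by rewrite le_eqVlt; apply/orP; left; exact/eqP.
rewrite leNgt; apply/negP => zv.
have Sab y : S y -> a <= y <= b.
  by move=> [/Eab /=]; rewrite in_itv.
have Sz y : S y -> y != z.
  by move=> [_ yv]; apply/eqP => yz; move: zv; rewrite -yz ltNge yv.
(* [sup L] and [inf U] are the ends of the gap around [z]. Lower semicontinuity bounds the potential
   there by [v], even if they lie outside [S], so neither of them is [z]. *)
pose L := [set y | S y /\ y < z]; pose U := [set y | S y /\ z < y].
have supL : L !=set0 -> (potential D rho (sup L) <= v%:E)%E /\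
    ubound L (sup L) /\ a <= sup L < z.
  move=> L0; have hL : has_sup L.
    by split => //; exists z => y [_ /ltW].
  have pL : (potential D rho (sup L) <= v%:E)%E.
    apply: potential_lsc => e e0; have [y Ly yL] := sup_adherent e0 hL.
    exists y; split; last by have [[]] := Ly.
    have yle : y <= sup L by apply: sup_ubound => //; case: hL.
    by rewrite ger0_norm ?subr_ge0// ltrBlDl -ltrBlDr.
  split => //; split; first by apply: sup_ubound; case: hL.
  apply/andP; split.
    have [y Ly] := L0; have [/Sab/andP[ay _] _] := Ly; apply: (le_trans ay).
    by apply: sup_ubound => //; case: hL.
  rewrite lt_neqAle; apply/andP; split.
    by apply/eqP => Lz; move: zv; rewrite -Lz ltNge pL.
  by apply: ge_sup => // y [_ /ltW].
have infU : U !=set0 -> (potential D rho (inf U) <= v%:E)%E /\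
    lbound U (inf U) /\ z < inf U <= b.
  move=> U0; have hU : has_inf U.
    by split => //; exists z => y [_ /ltW].
  have pU : (potential D rho (inf U) <= v%:E)%E.
    apply: potential_lsc => e e0; have [y Uy yU] := inf_adherent e0 hU.
    exists y; split; last by have [[]] := Uy.
    have yge : inf U <= y by apply: inf_lbound => //; case: hU.
    by rewrite distrC ger0_norm ?subr_ge0// ltrBlDl.
  split => //; split; first by apply: inf_lbound; case: hU.
  apply/andP; split; last first.
    have [y Uy] := U0; have [/Sab/andP[_ yb] _] := Uy; apply: le_trans yb.
    by apply: inf_lbound => //; case: hU.
  rewrite lt_neqAle; apply/andP; split.
    by apply/eqP => Uz; move: zv; rewrite Uz ltNge pU.
  by apply: lb_le_inf => // y [_ /ltW].
have LU y : S y -> L y \/ U y.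
  by move=> Sy; have := Sz _ Sy; rewrite neq_lt => /orP[|]; [left|right].
move: zv; apply/negP; rewrite -leNgt.
(* Points of [S] on both sides call for convexity; with points on one side only, the kernel
   decreases as [z] moves away from them; with none, [rho] would have mass 0. *)
have [L0|nL0] := pselect (L !=set0); have [U0|nU0] := pselect (U !=set0).
- have [Lv [Lub /andP[aL Lz]]] := supL L0; have [Uv [Ulb /andP[zU Ub]]] := infU U0.
  set x1 := sup L in Lv Lub aL Lz; set x2 := inf U in Uv Ulb zU Ub.
  have x12 : 0 < x2 - x1 by lra.
  apply: (@potential_le_comb D rho S x1 x2 ((x2 - z) / (x2 - x1))
    ((z - x1) / (x2 - x1))) => //.
  + by apply: divr_ge0; lra.
  + by apply: divr_ge0; lra.
  + by field; lra.
  move=> y Sy; have /andP[ay yb] := Sab _ Sy.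
  have yz := Sz _ Sy.
  apply: pos_kernel_convex.
  + by apply: divr_gt0; lra.
  + by apply: divr_gt0; lra.
  + by field; lra.
  + by field; lra.
  + case: (LU _ Sy) => [/Lub|/Ulb] => H.
      by apply: mulr_ge0; lra.
    by apply: mulr_le0; lra.
  + by rewrite ler_norml; apply/andP; split; lra.
  + by rewrite ler_norml; apply/andP; split; lra.
  + rewrite normr_gt0 subr_eq0 eq_sym yz/=.
    by rewrite ler_norml; apply/andP; split; lra.
- have [Lv [Lub /andP[aL Lz]]] := supL L0.
  apply: (@potential_le_comb D rho S (sup L) (sup L) 1 0) => //.
    by rewrite addr0.
  move=> y Sy; rewrite mul1e mul0e adde0; have /andP[ay yb] := Sab _ Sy.
  have yL : y <= sup L by case: (LU _ Sy) => [/Lub//|Uy]; case: nU0; exists y.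
  have [<-|yL'] := eqVneq y (sup L); first by rewrite pos_kernelxx leey.
  have {}yL : y < sup L by rewrite lt_neqAle yL'.
  by apply: pos_kernel_mono; rewrite !gtr0_norm ?subr_gt0//;
    try (apply/andP; split); lra.
- have [Uv [Ulb /andP[zU Ub]]] := infU U0.
  apply: (@potential_le_comb D rho S (inf U) (inf U) 1 0) => //.
    by rewrite addr0.
  move=> y Sy; rewrite mul1e mul0e adde0; have /andP[ay yb] := Sab _ Sy.
  have yU : inf U <= y by case: (LU _ Sy) => [Ly|/Ulb//]; case: nL0; exists y.
  have [<-|yU'] := eqVneq y (inf U); first by rewrite pos_kernelxx leey.
  have {}yU : inf U < y by rewrite lt_neqAle eq_sym yU'.
  by apply: pos_kernel_mono; rewrite !ltr0_norm ?subr_lt0//;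
    try (apply/andP; split); lra.
- exfalso; have S0 : S = set0.
    by apply/seteqP; split => // y /LU[?|?]; [case: nL0|case: nU0]; exists y.
  move: rhoS; rewrite S0 setC0 => H.
  have := probability_setT rho; rewrite H => /eqP.
  by rewrite eq_sym onee_eq0.
Qed.

End maximum_principle.

(** * Lower bound for the norms of monic polynomials *)

Section lower_bound.
Variable R : realType.
Implicit Types (D x y z v : R) (s : seq R) (p : {poly R}).

(* Each complex root is replaced by its real part. *)
Lemma monic_ge_real_roots p n : p \is monic -> size p = n.+1 ->
  exists s, size s = n /\ forall x, \prod_(z <- s) `|x - z| <= `|p.[x]|.
Proof.
move=> pm sp; pose pC := map_poly (real_complex R) p.
have pCm : pC \is monic by rewrite map_monic.
have [r rE] := closed_field_poly_normal pC.
move: rE; rewrite (monicP pCm) scale1r => rE.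
exists (map (@complex.Re R) r); split.
  rewrite size_map; apply/eqP; rewrite -eqSS -sp -(size_prod_XsubC _ idfun).
  by rewrite -rE size_map_poly.
move=> x; rewrite -lecR.
have -> : (`|p.[x]|%:C = `|pC.[x%:C]|)%C.
  by rewrite horner_map/= normc_def/= expr0n/= addr0 sqrtr_sqr.
rewrite rE horner_prod normr_prod big_map.
rewrite (rmorph_prod (real_complex R)); apply: ler_prod => z _.
rewrite ler0c normr_ge0/= hornerXsubC.
by apply: le_trans (normc_ge_Re _); rewrite raddfB.
Qed.

Definition clamp (a b z : R) : R := Num.max a (Num.min z b).

Lemma clamp_itv (a b z : R) : a <= b -> a <= clamp a b z <= b.
Proof. by move=> ab; rewrite /clamp le_max lexx ge_max ab ge_min lexx orbT. Qed.

Lemma dist_clamp (a b x z : R) : a <= x <= b -> `|x - clamp a b z| <= `|x - z|.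
Proof.
move=> /andP[ax xb]; rewrite /clamp.
have [zb|bz] := leP z b.
  have [az|za] := leP z a => //.
  by rewrite !ger0_norm; lra.
have [ab|ba] := leP b a; rewrite !ler0_norm; lra.
Qed.

(** A root outside the interval is moved to the nearest end point, which brings it closer to every
    point of the interval. The bound on the potential then applies at every root. *)
Lemma monic_ge_roots_itv (a b : R) p n : a <= b -> p \is monic -> size p = n.+1 ->
  exists s, [/\ size s = n, forall z, z \in s -> a <= z <= b &
    forall x, a <= x <= b -> \prod_(z <- s) `|x - z| <= `|p.[x]|].
Proof.
move=> ab pm sp; have [s [ss sle]] := monic_ge_real_roots pm sp.
exists (map (clamp a b) s); split.
- by rewrite size_map.
- by move=> z /mapP[y _ ->]; exact: clamp_itv.
move=> x xab; apply: le_trans (sle x); rewrite big_map; apply: ler_prod => z _.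
by rewrite normr_ge0/= dist_clamp.
Qed.

Lemma ln_prod s (f : R -> R) : (forall z, z \in s -> 0 < f z) ->
  ln (\prod_(z <- s) f z) = \sum_(z <- s) ln (f z).
Proof.
elim: s => [|z s IH] f0; first by rewrite !big_nil ln1.
have fs y : y \in s -> 0 < f y by move=> ys; apply: f0; rewrite inE ys orbT.
rewrite !big_cons lnM ?IH// ?posrE ?f0 ?mem_head//.
by rewrite big_seq prodr_gt0.
Qed.

Lemma sum_const_seq (T : Type) (r : seq T) v : \sum_(z <- r) v = v *+ size r.
Proof. by rewrite big_const_seq count_predT iter_addr_0. Qed.

(** Taking [- ln] turns the product into a sum of kernels; if [x] is one of the points, its own
    kernel is infinite. *)
Lemma sum_pos_kernel_ge D (a b x c : R) s : b - a <= D -> 0 < c ->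
  a <= x <= b -> (forall z, z \in s -> a <= z <= b) ->
  \prod_(z <- s) `|x - z| <= c ^+ size s ->
  (((size s)%:R * (ln D - ln c))%:E <= \sum_(z <- s) pos_kernel D z x)%E.
Proof.
move=> abD c0 /andP[ax xb] sab sc.
have [xs|xs] := boolP (x \in s).
  rewrite (big_rem x)//= pos_kernelxx addye ?leey//.
  rewrite gt_eqF// (@lt_le_trans _ _ 0%E)//.
  by apply: sume_ge0 => z _; exact: pos_kernel_ge0.
have dist0 z : z \in s -> 0 < `|x - z|.
  by move=> zs; rewrite normr_gt0 subr_eq0; apply: contraNneq xs => ->.
rewrite big_seq (eq_bigr (fun z => (ln D - ln `|x - z|)%:E)); last first.
  move=> z zs; rewrite pos_kernelC pos_kernelE// dist0//=.
  have /andP[az zb] := sab _ zs.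
  by rewrite ler_norml; apply/andP; split; lra.
rewrite -big_seq sumEFin lee_fin sumrB sum_const_seq.
rewrite mulrBr mulr_natl lerB// mulr_natl -lnXn// -ln_prod//.
by rewrite ler_ln ?posrE ?exprn_gt0// big_seq prodr_gt0.
Qed.

(** Absolute continuity of a finite measure in its epsilon-delta form, obtained by viewing [nu] as a
    charge and bounding it by its variation. *)
Lemma dominated_small (mu nu : {finite_measure set R -> \bar R}) (e : R) :
  nu `<< mu -> 0 < e -> exists2 d : R, 0 < d &
  forall A, measurable A -> (mu A < d%:E)%E -> (nu A < e%:E)%E.
Proof.
move=> numu e0; pose nu' := charge_of_finite_measure nu.
have [P [N PN]] := Hahn_decomposition nu'.
have [d [d0 dH]] := charge_variation_continuous PN numu e0.
exists d => // A mA muA; apply: le_lt_trans (dH A mA muA).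
by apply: le_trans (abse_charge_variation PN mA); rewrite gee0_abs// measure_ge0.
Qed.

Lemma measurable_poly p : measurable_fun setT (fun x => p.[x]).
Proof. by apply: continuous_measurable_fun; exact: continuous_horner. Qed.

(** Chebyshev's inequality for the square of [p]. *)
Lemma measure_square_ge (mu : {measure set R -> \bar R}) p (c : R) : 0 < c ->
  measurable [set x | c <= `|p.[x]|] ->
  ((c ^+ 2)%:E * mu [set x | (c <= `|p.[x]|)%R] <= \int[mu]_x ((p.[x]) ^+ 2)%:E)%E.
Proof.
move=> c0 mB; set B := [set x | _] in mB *.
have mg : measurable_fun setT (fun x => ((p.[x]) ^+ 2)%:E).
  by apply/measurable_EFinP; apply: measurable_funX; exact: measurable_poly.
have sq0 x : (0 <= ((p.[x]) ^+ 2)%:E)%E by rewrite lee_fin sqr_ge0.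
apply: (@le_trans _ _ (\int[mu]_(x in B) ((p.[x]) ^+ 2)%:E)%E).
  rewrite -integral_cst//; apply: ge0_le_integral => //.
  - by move=> x _; rewrite lee_fin sqr_ge0.
  - exact: measurable_funTS.
  move=> x Bx; rewrite lee_fin -[leRHS]real_normK ?num_real//.
  by rewrite ler_sqr ?nnegrE// ltW.
by apply: ge0_subset_integral.
Qed.

Lemma monic_L2_ge (mu : {finite_measure set R -> \bar R}) (rho : probability R R)
    D E (a b v c c' : R) :
  measurable E -> prob_on E rho -> E `<=` `[a, b] -> a <= b -> b - a <= D ->
  rho `<< mu -> (forall z, a <= z <= b -> (potential D rho z <= v%:E)%E) ->
  0 <= v -> 0 < c -> c < c' -> v < ln D - ln c' ->
  \forall n \near \oo, forall p, p \is monic -> size p = n.+1 ->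
    ((c ^+ n.*2)%:E <= \int[mu]_x ((p.[x]) ^+ 2)%:E)%E.
Proof.
move=> mE rhoE Eab ab abD rhomu rhov v0 c0 cc' vg.
have c'0 := lt_trans c0 cc'.
set g := ln D - ln c' in vg.
have g0 : 0 < g by exact: le_lt_trans vg.
(* With this choice [g * (1 - e)] is the midpoint of [v] and [g], hence still above [v]. *)
pose e := (g - v) / (2 * g).
have e0 : 0 < e by apply: divr_gt0; lra.
have ge : g * (1 - e) = (g + v) / 2 by rewrite /e; field; rewrite gt_eqF.
have [d d0 dH] := dominated_small rhomu e0.
have q1 : `|(c / c') ^+ 2| < 1.
  rewrite ger0_norm ?sqr_ge0// expr_lt1// ?divr_ge0// ?ltW//.
  by rewrite ltr_pdivrMr// mul1r.
(* The threshold on [n] depends on [c], [c'] and [d] only, so it serves all [p] of degree [n] at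
   once. *)
near=> n => p pm sp; rewrite leNgt; apply/negP => pc.
have n0 : (0 < n)%N by near: n; exact: nbhs_infty_gt.
have qd : (c / c') ^+ n.*2 < d.
  rewrite -mul2n exprM.
  suff : `|0 - (c / c') ^+ 2 ^+ n| < d.
    by rewrite sub0r normrN ger0_norm// exprn_ge0// sqr_ge0.
  by near: n; move/cvgrPdist_lt : (cvg_expr q1); exact.
pose B := [set x | c' ^+ n <= `|p.[x]|].
have mB : measurable B.
  rewrite -[B]setTI; apply: (measurable_fun_le (f := cst (c' ^+ n))
    (g := fun x => `|p.[x]|)) => //.
  by apply: measurableT_comp => //; exact: measurable_poly.
have c'n0 : 0 < c' ^+ n by rewrite exprn_gt0.
have muB : (mu B < d%:E)%E.
  rewrite ltNge; apply/negP => dB.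
  have : (((c' ^+ n) ^+ 2)%:E * d%:E < (c ^+ n.*2)%:E)%E.
    apply: le_lt_trans pc; apply: le_trans (measure_square_ge mu c'n0 mB).
    by rewrite lee_pmul2l// lte_fin exprn_gt0.
  rewrite -EFinM lte_fin ltNge => /negP; apply.
  move: qd; rewrite expr_div_n ltr_pdivrMr ?exprn_gt0// => /ltW.
  by rewrite mulrC -exprM muln2.
have rhoB := dH _ mB muB.
have [s [ss sab sp']] := monic_ge_roots_itv ab pm sp.
(* The integral of [F] is the sum of the potentials at the [n] roots, at most [n * v]. On the other
   hand [F] is at least [n * g] at the points of [E] off [B], which have mass more than [1 - e]. *)
pose F x := (\sum_(z <- s) pos_kernel D z x)%E.
have F0 x : (0 <= F x)%E by apply: sume_ge0 => z _; exact: pos_kernel_ge0.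
have mF : measurable_fun setT F.
  by apply: emeasurable_sum => z _; exact: measurable_pos_kernel1.
have intF : (\int[rho]_x F x <= (n%:R * v)%:E)%E.
  rewrite /F ge0_integral_sum//; last 2 first.
  - by move=> z; exact: measurable_pos_kernel1.
  - by move=> z x _; exact: pos_kernel_ge0.
  rewrite -ss mulr_natl -sum_const_seq -sumEFin big_seq [leRHS]big_seq.
  by apply: lee_sum => z /sab; exact: rhov.
have mB' := measurableC mB.
have rhoB' : rho (~` B) = (1 - fine (rho B))%:E.
  by rewrite probability_setC// EFinB fineK// fin_num_measure.
have intF' : ((n%:R * g * (1 - fine (rho B)))%:E <= \int[rho]_x F x)%E.
  apply: (@le_trans _ _ (\int[rho]_(x in ~` B) F x)%E); last first.
    by apply: ge0_subset_integral.
  rewrite EFinM -rhoB' -integral_cst//; apply: ae_ge0_le_integral => //.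
  - by move=> x _; rewrite lee_fin mulr_ge0// ltW.
  - exact: measurable_funTS.
  exists (~` E); split => //; first exact: measurableC.
  move=> x /= nF Ex; apply: nF => nB; rewrite -ss.
  have xab : a <= x <= b by have := Eab _ Ex; rewrite /= in_itv.
  apply: (@sum_pos_kernel_ge D a b x c' s) => //.
  rewrite ss (le_trans (sp' _ xab))// ltW// ltNge.
  exact/negP.
have := le_trans intF' intF.
rewrite lee_fin -mulrA ler_pM2l ?ltr0n//.
have : fine (rho B) < e by rewrite -lte_fin fineK// fin_num_measure.
move=> Be; apply/negP; rewrite -ltNge.
apply: (@lt_trans _ _ (g * (1 - e))); first by rewrite ge; lra.
by rewrite ltr_pM2l// ltrD2l ltrN2.
Unshelve. all: by end_near. Qed.

End lower_bound.

(** * The uniform law, quantile functions and Helly selection *)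

Section quantiles.
Variable R : realType.
Implicit Types (D x y z : R) (s : seq R) (N n : nat).

(** For [t] in the unit interval, the index of a cell of mesh [1 / N] containing [t]; the minimum
    puts [t = 1] into the last cell. *)
Definition grid_index N (t : R) : nat := minn N.-1 (Num.truncn (N%:R * t)).

Lemma grid_index_lt N t : (0 < N)%N -> (grid_index N t < N)%N.
Proof. by case: N => // N _; rewrite /grid_index ltnS geq_minl. Qed.

Lemma grid_index_mono N : {homo grid_index N : t u / t <= u >-> (t <= u)%N}.
Proof.
move=> t u tu; rewrite /grid_index leq_min geq_minl/=.
by rewrite (leq_trans (geq_minr _ _))// le_truncn// ler_wpM2l.
Qed.

Lemma grid_index_itv N t : (0 < N)%N -> 0 <= t <= 1 ->
  (grid_index N t)%:R / N%:R <= t <= (grid_index N t).+1%:R / N%:R.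
Proof.
move=> N0 /andP[t0 t1]; have N0' : 0 < N%:R :> R by rewrite ltr0n.
have /andP[tr1 tr2] := truncn_itv (mulr_ge0 (ltW N0') t0).
rewrite ler_pdivrMr// ler_pdivlMr// [t * _]mulrC; apply/andP; split.
  by rewrite (le_trans _ tr1)// ler_nat geq_minr.
rewrite /grid_index; case: leqP => _; last exact: ltW.
by rewrite prednK// ler_piMr// ltW.
Qed.

(** The two properties of the uniform law on the unit interval from which the integral bounds below
    are derived. *)
Definition unit_prob_spec (P : probability R R) : Prop :=
  prob_on `[0, 1] P /\ forall N i, (i < N)%N ->
    P `[i%:R / N%:R, i.+1%:R / N%:R]%classic = (N%:R^-1)%:E.

Lemma exists_unit_prob : exists P : probability R R, unit_prob_spec P.
Proof.
(* [Q] is a measure on [measurableTypeR R]; its image under the identity is a measure on [R]. *)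
pose Q := uniform_prob (@ltr01 R) : probability (measurableTypeR R) R.
have mid : measurable_fun (T := measurableTypeR R) (U := R) setT (fun x : R => x).
  by move=> _ U mU; rewrite setTI.
pose idQ : {mfun measurableTypeR R >-> R} :=
  HB.pack (fun x : R => x) (isMeasurableFun.Build _ _ _ _ _ mid).
pose P : probability R R := distribution Q idQ.
have PE U : measurable U -> P U = lebesgue_measure (U `&` `[0, 1]).
  move=> mU; change (uniform_prob (@ltr01 R) U = lebesgue_measure (U `&` `[0, 1])).
  transitivity (\int[uniform_prob (@ltr01 R)]_t (\1_U t)%:E)%E.
    by rewrite integral_indic// setIT.
  rewrite integral_uniform//; last by apply/measurable_EFinP/measurable_indic.
  by rewrite subr0 invr1 mul1e integral_indic.
exists P; split.
  by rewrite /prob_on PE ?setICl ?measure0//; exact: measurableC.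
move=> N i iN; have N0 : 0 < N%:R :> R by rewrite ltr0n (leq_ltn_trans _ iN).
rewrite PE// setIidl; last first.
  move=> x /=; rewrite !in_itv/= => /andP[ix xi]; apply/andP; split.
    by rewrite (le_trans _ ix)// divr_ge0// ltW.
  by rewrite (le_trans xi)// ler_pdivrMr// mul1r ler_nat.
rewrite lebesgue_measure_itv/= lte_fin ltr_pM2r ?invr_gt0// ltr_nat ltnSn.
by rewrite -EFinB -mulrBl -natr1 addrAC subrr add0r mul1r.
Qed.

(** A step function with value [c i] on cell [i] dominates [h], and each cell has mass [1 / N]. The
    closed cells overlap at their ends, which only adds nonnegative terms to the upper bound. *)
Lemma integral_grid_le P N (h : R -> \bar R) (c : nat -> R) :
  unit_prob_spec P -> (0 < N)%N -> measurable_fun setT h ->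
  (forall t, 0 <= h t)%E -> (forall i, 0 <= c i) ->
  (forall t, 0 <= t <= 1 -> (h t <= (c (grid_index N t))%:E)%E) ->
  (\int[P]_t h t <= ((\sum_(i < N) c i) / N%:R)%:E)%E.
Proof.
move=> [P01 PN] N0 mh h0 c0 hc.
pose I i : set R := `[i%:R / N%:R, i.+1%:R / N%:R]%classic.
have mI1 i : measurable_fun setT (fun t : R => (\1_(I i) t : R)%:E).
  by apply/measurable_EFinP/measurable_indic; exact: measurable_itv.
have mI i : measurable_fun setT (fun t => (c i)%:E * (\1_(I i) t)%:E)%E.
  exact: measurable_funeM.
have I0 i t : (0 <= (c i)%:E * (\1_(I i) t)%:E)%E.
  by rewrite mule_ge0// lee_fin.
apply: (@le_trans _ _ (\int[P]_t \sum_(i < N) ((c i)%:E * (\1_(I i) t)%:E))%E).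
  apply: ae_ge0_le_integral => //.
  - by move=> t _; apply: sume_ge0.
  - by apply: emeasurable_sum.
  apply: (ae_prob_on _ P01) => // t; rewrite /= in_itv/= => t01.
  apply: (le_trans (hc _ t01)).
  rewrite (bigD1 (Ordinal (grid_index_lt t N0)))//= indicE mem_set; last first.
    by rewrite /I /= in_itv/= grid_index_itv.
  by rewrite mule1 leeDl// sume_ge0.
rewrite ge0_integral_sum// mulr_suml -sumEFin; apply: lee_sum => i _.
rewrite ge0_integralZl//; last by rewrite lee_fin.
rewrite integral_indic//; last exact: measurable_itv.
rewrite setIT EFinM [X in (_ * X <= _)%E](_ : _ = (N%:R^-1)%:E)//.
exact: PN.
Qed.

Lemma ultra_fmap (T V : Type) (g : T -> V) (F : set_system T) :
  UltraFilter F -> UltraFilter (g @ F).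
Proof.
move=> UF; split; first exact: fmap_proper_filter.
move=> G GP FG; apply/seteqP; split => // A GA.
have [//|FnA] := in_ultra_setVsetC (g @^-1` A) UF.
have GnA : G (~` A) by exact: FG.
have : G set0 by rewrite -(setICr A); exact: filterI.
by move/filter_not_empty.
Qed.

(* Helly selection: an ultrafilter picks all the pointwise limits at once. *)
Lemma exists_monotone_limit (E : set R) (f_ : nat -> R -> R) : compact E ->
  (forall n t, E (f_ n t)) -> (forall n, {homo f_ n : t u / t <= u}) ->
  exists f : R -> R, [/\ forall t, E (f t), {homo f : t u / t <= u} &
    forall (ts : seq R) (e : R), 0 < e -> forall m, exists2 n, (m <= n)%N &
      forall t, t \in ts -> `|f t - f_ n t| < e].
Proof.
move=> cE Ef ndf.
have [U [UU subU]] := ultraFilterLemma (@eventually_filter).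
have lim_ t : exists l, E l /\ f_ n t @[n --> U] --> l.
  have EU : \forall n \near U, E (f_ n t) by apply: nearW => n; exact: Ef.
  have := cE; rewrite compact_ultra => /(_ _ (ultra_fmap (f_^~ t) UU) EU).
  by move=> [l [El lim_l]]; exists l.
have [f fP] := choice lim_.
exists f; split.
- by move=> t; have [] := fP t.
- move=> t u tu; have [_ ft] := fP t; have [_ fu] := fP u.
  by apply: (ler_cvg_to ft fu); apply: filterS filterT => n _; exact: ndf.
move=> ts e e0 m.
have H : \forall n \near U, forall t, t \in ts -> `|f t - f_ n t| < e.
  elim: ts => [|t ts IH]; first by apply: filterS filterT.
  have [_ ft] := fP t.
  have Ht : \forall n \near U, `|f t - f_ n t| < e.
    by move/cvgrPdist_lt : ft; exact.
  by apply: filterS2 Ht IH => n nt nts u; rewrite inE => /orP[/eqP->|/nts].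
(* [U] contains every tail, so the index can also be taken beyond [m]. *)
have Hm : \forall n \near U, (m <= n)%N.
  by apply: subU; exact: nbhs_infty_ge.
have [n [nm nH]] := filter_ex (filterI Hm H).
by exists n.
Qed.

(** The quantile function of the empirical measure of [s]; being monotone in [t], it is suited to
    Helly's theorem. *)
Definition quantile s (t : R) : R :=
  nth 0 (sort <=%O s) (grid_index (size s) t).

Lemma quantile_mono s : (0 < size s)%N -> {homo quantile s : t u / t <= u}.
Proof.
move=> s0 t u tu.
have sS : sorted <=%O (sort <=%O s) by apply: sort_sorted; exact: le_total.
apply: (sorted_leq_nth le_trans le_refl 0 sS); rewrite ?inE ?size_sort ?grid_index_lt//.
exact: grid_index_mono.
Qed.

Lemma quantile_in s t : (0 < size s)%N -> quantile s t \in s.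
Proof.
move=> s0; have <- : sort <=%O s =i s by exact: mem_sort.
by rewrite mem_nth// size_sort grid_index_lt.
Qed.

Lemma sum_quantile s (g : R -> R) :
  \sum_(i < size s) g (nth 0 (sort <=%O s) i) = \sum_(x <- s) g x.
Proof.
have sz : size (sort <=%O s) = size s by rewrite size_sort.
rewrite -[in LHS]sz -(big_mkord xpredT (fun i => g (nth 0 (sort <=%O s) i))).
rewrite -(big_nth 0 xpredT g).
by apply: perm_big; rewrite perm_sort.
Qed.

Lemma integral_quantile_le P s (g : R -> R) : unit_prob_spec P -> (0 < size s)%N ->
  measurable_fun setT g -> (forall x, 0 <= g x) ->
  (\int[P]_t (g (quantile s t))%:E <= ((\sum_(x <- s) g x) / (size s)%:R)%:E)%E.
Proof.
move=> PP s0 mg g0; rewrite -sum_quantile.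
apply: (integral_grid_le (c := fun i => g (nth 0 (sort <=%O s) i)) PP s0) => //.
  apply/measurable_EFinP; apply: (measurableT_comp mg).
  by apply: nondecreasing_measurable => //; exact: quantile_mono.
by move=> t; rewrite lee_fin.
Qed.

(** Both functions are monotone, so within a cell their distance is at most the increase of [f]
    across the cell plus [e]. The increases telescope to [f 1 - f 0]. *)
Lemma integral_dist_le P N (f g : R -> R) (D e : R) : unit_prob_spec P ->
  (0 < N)%N -> {homo f : t u / t <= u} -> {homo g : t u / t <= u} ->
  (forall i, (i <= N)%N -> `|f (i%:R / N%:R) - g (i%:R / N%:R)| <= e) ->
  f 1 - f 0 <= D -> 0 <= e ->
  (\int[P]_t (`|f t - g t|)%:E <= (D / N%:R + e)%:E)%E.
Proof.
move=> PP N0 ndf ndg fg fD e0.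
have N0' : 0 < N%:R :> R by rewrite ltr0n.
pose c i := f (i.+1%:R / N%:R) - f (i%:R / N%:R) + e.
have c0 i : 0 <= c i.
  by rewrite addr_ge0// subr_ge0 ndf// ler_pM2r ?invr_gt0// ler_nat.
apply: le_trans (integral_grid_le (c := c) PP N0 _ _ c0 _) _.
- apply/measurable_EFinP; apply: measurableT_comp => //.
  by apply: measurable_funB; exact: nondecreasing_measurable.
- by move=> t; rewrite lee_fin.
- move=> t t01; rewrite lee_fin /c.
  have iN := grid_index_lt t N0; have /andP[it ti] := grid_index_itv N0 t01.
  set i := grid_index N t in iN it ti *.
  have := fg _ (ltnW iN); have := fg _ iN; rewrite !ler_norml.
  move=> /andP[? ?] /andP[? ?].
  have := ndf _ _ it; have := ndf _ _ ti; have := ndg _ _ it; have := ndg _ _ ti.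
  by move=> *; apply/andP; split; lra.
rewrite lee_fin /c big_split/= sumr_const card_ord mulrDl.
rewrite -(big_mkord xpredT (fun i => f (i.+1%:R / N%:R) - f (i%:R / N%:R))).
rewrite (telescope_sumr (fun i => f (i%:R / N%:R)))// mul0r divff ?gt_eqF//.
by rewrite -[e *+ N]mulr_natr mulfK ?gt_eqF// lerD2r ler_pM2r ?invr_gt0.
Qed.

End quantiles.

(** * Measures of low energy from Leja points *)

Section chebyshev.
Variable R : realType.
Implicit Types (D d r x y z : R) (s : seq R) (E : set R).

(** Monotone convergence in the inner and then in the outer integral; only Lipschitz kernels remain
    to be estimated. *)
Lemma energy_le_of_trunc D (nu : probability R R) (c : R) :
  (forall m, (\int[nu]_x \int[nu]_y (trunc_kernel D m.+1%:R^-1 x y)%:E <= c%:E)%E) ->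
  (energy D nu <= c%:E)%E.
Proof.
move=> H.
have mk d x : measurable_fun setT (fun y => (trunc_kernel D d x y)%:E).
  by apply/measurable_EFinP; exact: measurable_trunc_kernel1.
have k0 d x y : (0 <= (trunc_kernel D d x y)%:E)%E.
  by rewrite lee_fin trunc_kernel_ge0.
have ndk x y : {homo (fun m => (trunc_kernel D m.+1%:R^-1 x y)%:E) :
    n m / (n <= m)%N >-> (n <= m)%E}.
  move=> n m nm; rewrite lee_fin trunc_kernel_nondec// invr_gt0 ltr0n/=.
  by rewrite lef_pV2 ?posrE// ler_nat.
apply: (@integral_le_of_cvg _ _ _
  (fun m x => (\int[nu]_y (trunc_kernel D m.+1%:R^-1 x y)%:E)%E)) => //.
- move=> m; apply: (@measurable_fun_fubini_tonelli_F _ _ _ _ R nu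
    (fun z : R * R => (trunc_kernel D m.+1%:R^-1 z.1 z.2)%:E)) => //.
  by apply/measurable_EFinP; exact: measurable_trunc_kernel.
- by move=> m x _; apply: integral_ge0.
- by move=> x _ n m nm; apply: ge0_le_integral => // y _; exact: ndk.
move=> x _; rewrite /potential.
rewrite (eq_integral (fun y => limn (fun m => (trunc_kernel D m.+1%:R^-1 x y)%:E))).
  exact: cvg_monotone_convergence.
by move=> y _; apply/esym/cvg_lim => //; exact: cvg_trunc_kernel.
Qed.

Lemma sum_trunc_kernel_le D d r (x : R) s : 0 < d -> 0 < r ->
  (forall z, z \in s -> `|x - z| <= D) ->
  r ^+ size s <= \prod_(z <- s) `|x - z| ->
  \sum_(z <- s) trunc_kernel D d x z <= (size s)%:R * (ln D - ln r).
Proof.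
move=> d0 r0 sD rs.
have prod0 : 0 < \prod_(z <- s) `|x - z| by apply: lt_le_trans rs; rewrite exprn_gt0.
have dist0 z : z \in s -> 0 < `|x - z|.
  move=> zs; rewrite lt_def normr_ge0 andbT.
  by apply: contraTneq prod0 => xz; rewrite (big_rem z)//= xz mul0r ltxx.
apply: (@le_trans _ _ (\sum_(z <- s) (ln D - ln `|x - z|))).
  rewrite big_seq [leRHS]big_seq; apply: ler_sum => z zs.
  by rewrite -lee_fin -pos_kernelE ?dist0 ?sD//; exact: trunc_kernel_le.
rewrite sumrB sum_const_seq mulrBr mulr_natl lerB// mulr_natl -lnXn// -ln_prod//.
by rewrite ler_ln ?posrE ?exprn_gt0.
Qed.

Lemma double_sum_cons (k : R -> R -> R) x s : (forall y z, k y z = k z y) ->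
  \sum_(u <- x :: s) \sum_(w <- x :: s) k u w =
  \sum_(u <- s) \sum_(w <- s) k u w + 2 * \sum_(w <- s) k x w + k x x.
Proof.
move=> kC; rewrite big_cons big_cons.
under [X in _ + X = _]eq_bigr do rewrite big_cons.
rewrite big_split/=.
have -> : \sum_(i <- s) k i x = \sum_(w <- s) k x w by apply: eq_bigr => i _.
by ring.
Qed.

Lemma trunc_kernelC D d x y : trunc_kernel D d x y = trunc_kernel D d y x.
Proof. by rewrite /trunc_kernel distrC. Qed.

(* Leja points: each new point is chosen where the monic polynomial vanishing at
   the previous ones is large. *)
Lemma exists_leja E r : 0 < r ->
  (forall p : {poly R}, p \is monic -> exists2 x, E x & r ^+ (size p).-1 <= `|p.[x]|) ->
  forall n, exists s, [/\ size s = n, forall x, x \in s -> E x &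
    forall D d, 0 < d <= D -> (forall x y, E x -> E y -> `|x - y| <= D) ->
    \sum_(u <- s) \sum_(w <- s) trunc_kernel D d u w <=
      n%:R * n.-1%:R * (ln D - ln r) + n%:R * (ln D - ln d)].
Proof.
move=> r0 H; elim=> [|n [s [sn sE sD]]].
  by exists [::]; split => // *; rewrite big_nil !mul0r addr0.
have [x Ex rx] := H (\prod_(z <- s) ('X - z%:P)) (monic_prod_XsubC _ _ _).
move: rx; rewrite size_prod_XsubC/= horner_prod normr_prod => rx.
exists (x :: s); split.
- by rewrite /= sn.
- by move=> y; rewrite inE => /orP[/eqP->|/sE].
move=> D d /andP[d0 dD] ED; rewrite double_sum_cons; last exact: trunc_kernelC.
have H1 := sD D d; rewrite d0 dD in H1; have {}H1 := H1 isT ED.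
have H2 := @trunc_kernel_le_bound _ D d x x; rewrite d0 dD in H2.
have {}H2 := H2 isT.
have H3 : \sum_(w <- s) trunc_kernel D d x w <= n%:R * (ln D - ln r).
  rewrite -sn; apply: sum_trunc_kernel_le => //; first by move=> z /sE; exact: ED.
  apply: le_trans rx _; rewrite le_eqVlt; apply/orP; left; apply/eqP.
  by apply: eq_bigr => z _; rewrite hornerXsubC.
(* The new point adds [2 * n] off-diagonal terms, bounded by [ln D - ln r] on average, and one
   diagonal term. *)
have -> : n.+1%:R * n.+1.-1%:R * (ln D - ln r) + n.+1%:R * (ln D - ln d) =
  n%:R * n.-1%:R * (ln D - ln r) + n%:R * (ln D - ln d) +
  2 * (n%:R * (ln D - ln r)) + (ln D - ln d).
  by case: n {sn sD H1 H3} => [|n]/=; rewrite -?natr1; ring.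
by rewrite lerD// lerD// ler_wpM2l.
Qed.

(** The measure is the image of the uniform law under a limit of the quantile functions of Leja
    points. The cutoff [d] is fixed before the number of points grows, so the diagonal terms,
    bounded by [ln D - ln d], disappear in the average and the others give [ln D - ln r]. *)
Lemma exists_low_energy E r D : compact E -> 0 < r -> 1 <= D ->
  (forall x y, E x -> E y -> `|x - y| <= D) ->
  (forall p : {poly R}, p \is monic -> exists2 x, E x & r ^+ (size p).-1 <= `|p.[x]|) ->
  exists nu : probability R R, prob_on E nu /\
    (energy D nu <= (ln D - ln r)%:E)%E.
Proof.
move=> cE r0 D1 ED H.
have [L LP] := choice (exists_leja r0 H).
(* The shifted index keeps the lists nonempty, so that [quantile] takes its values in [E]. *)
have Ls n : size (L n.+1) = n.+1 by have [] := LP n.+1.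
have LE n t : E (quantile (L n.+1) t).
  by have [_ LE _] := LP n.+1; apply/LE/quantile_in; rewrite Ls.
have [f [Ef ndf flim]] := exists_monotone_limit cE LE
  (fun n => @quantile_mono _ (L n.+1) ltac:(by rewrite Ls)).
have [P PP] := exists_unit_prob R.
have mf : measurable_fun setT f by exact: nondecreasing_measurable.
pose fX : {RV P >-> R} := HB.pack f (isMeasurableFun.Build _ _ _ _ _ mf).
pose nu : probability R R := distribution P fX.
have mE : measurable E.
  by apply: closed_measurable; apply: compact_closed => //; exact: Rhausdorff.
exists nu; split.
  rewrite /prob_on.
  suff -> : nu (~` E) = P set0 by rewrite measure0.
  by congr (P _); apply/seteqP; split => // t /=; apply; exact: Ef.
apply: energy_le_of_trunc => m.
set d := m.+1%:R^-1.
have d0 : 0 < d by rewrite invr_gt0.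
have dD : 0 < d <= D.
  by rewrite d0 (le_trans _ D1)// invf_le1// ler1n.
have mk x : measurable_fun setT (trunc_kernel D d x) by exact: measurable_trunc_kernel1.
have kb x y : 0 <= trunc_kernel D d x y by exact: trunc_kernel_ge0.
have nuE (g : R -> R) : measurable_fun setT g -> (forall x, 0 <= g x) ->
    (\int[nu]_x (g x)%:E = \int[P]_t (g (f t))%:E)%E.
  move=> mg g0; rewrite ge0_integral_distribution//.
  exact/measurable_EFinP.
have -> : (\int[nu]_x \int[nu]_y (trunc_kernel D d x y)%:E =
    \int[P]_s \int[P]_t (trunc_kernel D d (f s) (f t))%:E)%E.
  rewrite ge0_integral_distribution//; last 2 first.
  - apply: (@measurable_fun_fubini_tonelli_F _ _ _ _ R nu
      (fun z : R * R => (trunc_kernel D d z.1 z.2)%:E)) => [|z].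
      by apply/measurable_EFinP; exact: measurable_trunc_kernel.
    by rewrite lee_fin.
  - by move=> y; apply: integral_ge0 => z _; rewrite lee_fin.
  by apply: eq_integral => t _ /=; rewrite nuE.
apply/lee_addgt0Pr => e e0.
set B := ln D - ln d; set c := ln D - ln r.
(* The error [e] is split in three: the mesh of the grid, the distance [eta] at the grid points, and
   the diagonal. The factor [2 * d^-1] is the Lipschitz constant, once for each variable. *)
have [N [N0 NH]] : exists N, (0 < N)%N /\ 2 * d^-1 * (D / N%:R) <= e / 3.
  have D0 : 0 < D by exact: lt_le_trans D1.
  exists (Num.truncn (6 * d^-1 * D / e)).+1; split => //.
  have := truncnS_gt (6 * d^-1 * D / e); set M := (_.+1%:R) => HM.
  have M0 : 0 < M by rewrite ltr0n.
  rewrite mulrA ler_pdivrMr//; move: HM; rewrite ltr_pdivrMr// => HM.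
  by lra.
pose eta := d * e / 6.
have eta0 : 0 < eta by rewrite /eta; nra.
have etaE : 2 * d^-1 * eta = e / 3 by rewrite /eta; field; rewrite gt_eqF.
pose M := (Num.truncn (3 * `|B - c| / e)).+1.
have [n nM nH] := flim [seq i%:R / N%:R | i <- iota 0 N.+1] eta eta0 M.
set s := L n.+1 in nH.
have ss : size s = n.+1 by exact: Ls.
have s0 : (0 < size s)%N by rewrite ss.
pose g := quantile s.
have ndg : {homo g : t u / t <= u} by exact: quantile_mono.
have mg : measurable_fun setT g by exact: nondecreasing_measurable.
pose h t := `|f t - g t|.
have h0 t : 0 <= h t by exact: normr_ge0.
have mh : measurable_fun setT h.
  by apply: measurableT_comp => //; exact: measurable_funB.
have inth : (\int[P]_t (h t)%:E <= (D / N%:R + eta)%:E)%E.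
  apply: integral_dist_le => //.
  - move=> i iN; apply/ltW/nH; apply/mapP; exists i => //.
    by rewrite mem_iota.
  - by rewrite (le_trans (ler_norm _))// ED.
  - exact: ltW.
have d'0 : 0 <= d^-1 by rewrite invr_ge0 ltW.
set Dl := (D / N%:R + eta) in inth.
have mdh : measurable_fun setT (fun t => (d^-1 * h t)%:E).
  by apply/measurable_EFinP; exact: measurable_funM.
have dh0 t : (0 <= (d^-1 * h t)%:E)%E by rewrite lee_fin mulr_ge0.
have intdh : (\int[P]_t (d^-1 * h t)%:E <= (d^-1 * Dl)%:E)%E.
  have mh' : measurable_fun setT (fun t => (h t)%:E) by exact/measurable_EFinP.
  have h0' t : [set: R] t -> (0 <= (h t)%:E)%E by rewrite lee_fin.
  under eq_integral do rewrite EFinM.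
  rewrite ge0_integralZl//.
  by rewrite EFinM; apply: lee_wpmul2l => //; rewrite lee_fin.
(* The truncated potential of the empirical measure of [s]. *)
pose K u := (\sum_(w <- s) trunc_kernel D d u w) / (size s)%:R.
have mK : measurable_fun setT K.
  apply: measurable_funM => //; apply: measurable_sum => w.
  by under eq_fun do rewrite trunc_kernelC; exact: mk.
have K0 u : 0 <= K u by rewrite divr_ge0// sumr_ge0.
have inner t : (\int[P]_u (trunc_kernel D d (f t) (f u))%:E <=
    (K (g t) + d^-1 * h t + d^-1 * Dl)%:E)%E.
  apply: (@le_trans _ _ (\int[P]_u ((trunc_kernel D d (g t) (g u))%:E +
      (d^-1 * h t)%:E + (d^-1 * h u)%:E))%E).
    apply: ge0_le_integral => //.
    - by move=> u _; rewrite lee_fin.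
    - by apply/measurable_EFinP; exact: measurableT_comp (mk _) mf.
    - apply: emeasurable_funD => //; apply: emeasurable_funD => //.
      by apply/measurable_EFinP; exact: measurableT_comp (mk _) mg.
    move=> u _; rewrite -!EFinD lee_fin -addrA -mulrDr.
    exact: trunc_kernel_lip.
  rewrite ge0_integralD//; last 2 first.
  - by move=> u _; rewrite adde_ge0// lee_fin.
  - apply: emeasurable_funD => //.
    by apply/measurable_EFinP; exact: measurableT_comp (mk _) mg.
  rewrite ge0_integralD//; last 2 first.
  - by move=> u _; rewrite lee_fin.
  - by apply/measurable_EFinP; exact: measurableT_comp (mk _) mg.
  rewrite integral_cst_prob !EFinD leeD// leeD//.
  exact: integral_quantile_le.
apply: (@le_trans _ _ (\int[P]_t ((K (g t))%:E + (d^-1 * h t)%:E + (d^-1 * Dl)%:E))%E).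
  apply: ge0_le_integral => //.
  - by move=> t _; apply: integral_ge0 => u _; rewrite lee_fin.
  - have : measurable_fun setT (fun x => (\int[P]_u (trunc_kernel D d x (f u))%:E)%E).
      apply: (@measurable_fun_fubini_tonelli_F _ _ _ _ R P
        (fun z : R * R => (trunc_kernel D d z.1 (f z.2))%:E)) => [|z].
        apply/measurable_EFinP.
        have mz : measurable_fun setT (fun z : R * R => (z.1, f z.2)).
          apply: measurable_fun_pair => //.
          exact: (measurableT_comp mf measurable_snd).
        exact: measurableT_comp (measurable_trunc_kernel D d) mz.
      by rewrite lee_fin.
    by move=> mI; exact: measurableT_comp mI mf.
  - apply: emeasurable_funD => //; apply: emeasurable_funD => //.
    by apply/measurable_EFinP; exact: measurableT_comp mK mg.
have Dl0 : 0 <= Dl.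
  by rewrite addr_ge0 ?(ltW eta0)// divr_ge0// (le_trans _ D1).
rewrite ge0_integralD//; last 3 first.
- by move=> t _; rewrite adde_ge0// lee_fin.
- apply: emeasurable_funD => //.
  by apply/measurable_EFinP; exact: measurableT_comp mK mg.
- by move=> t _; rewrite lee_fin mulr_ge0.
rewrite ge0_integralD//; last 2 first.
- by move=> t _; rewrite lee_fin.
- by apply/measurable_EFinP; exact: measurableT_comp mK mg.
rewrite integral_cst_prob.
(* The double sum over the [n.+1] Leja points, divided by the square of [n.+1], is at most
   [(n * c + B) / n.+1]. *)
have intK : (\int[P]_t (K (g t))%:E <= (c + (B - c) / n.+1%:R)%:E)%E.
  apply: (le_trans (integral_quantile_le PP s0 mK K0)).
  rewrite lee_fin ss /K -mulr_suml ss.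
  have [_ _ /(_ D d dD ED)] := LP n.+1; rewrite -/s -/B -/c /= => S2.
  rewrite -mulrA -invfM ler_pdivrMr; last by rewrite mulr_gt0.
  apply: le_trans S2 _; rewrite le_eqVlt; apply/orP; left; apply/eqP.
  rewrite -[n.+1%:R]natr1; field.
  by rewrite natr1 pnatr_eq0.
apply: le_trans (leeD (leeD intK intdh) (lexx _)) _.
rewrite -!EFinD lee_fin.
have BcM : (B - c) / n.+1%:R <= e / 3.
  rewrite ler_pdivrMr ?ltr0n//; apply: le_trans (ler_norm _) _.
  have := truncnS_gt (3 * `|B - c| / e); rewrite -/M ltr_pdivrMr// => HM.
  have : M%:R <= n.+1%:R :> R by rewrite ler_nat (leq_trans nM).
  by move=> ?; nra.
have -> : c + (B - c) / n.+1%:R + d^-1 * Dl + d^-1 * Dl =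
    c + ((B - c) / n.+1%:R + (2 * d^-1 * (D / N%:R) + 2 * d^-1 * eta)).
  by rewrite /Dl; ring.
rewrite lerD2l etaE; apply: le_trans (lerD BcM (lerD NH (lexx _))) _.
by rewrite le_eqVlt; apply/orP; left; apply/eqP; field.
Qed.

End chebyshev.

(** * The support and its accumulation points *)

Section support.
Variable R : realType.
Implicit Types (mu : {measure set R -> \bar R}) (x y z : R).

Lemma closed_of_approx (A : set R) :
  (forall x, (forall e : R, 0 < e -> exists2 z, A z & `|x - z| < e) -> A x) ->
  closed A.
Proof.
move=> H x clx; apply: H => e e0.
have [z [Az zx]] := clx _ (nbhsx_ballx x e e0).
by exists z.
Qed.

Lemma msupp_closed mu : closed (msupp mu).
Proof.
apply: closed_of_approx => x H e e0.
have e20 : 0 < e / 2 by rewrite divr_gt0.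
have [z suppz xz] := H _ e20.
apply: lt_le_trans (suppz _ e20) _.
apply: le_measure; rewrite ?inE; try exact: measurable_ball.
move=> y; rewrite /ball/= => zy.
rewrite (_ : x - y = (x - z) + (z - y)); last by ring.
by rewrite (le_lt_trans (ler_normD _ _))// [ltRHS]splitr ltrD.
Qed.

Lemma sigma_ess_closed mu : closed (sigma_ess mu).
Proof.
apply: closed_of_approx => x H; split.
  apply: msupp_closed => U /nbhs_ballP[e /= e0 eU].
  by have [z [suppz _] xz] := H _ e0; exists z; split => //; exact: eU.
move=> e e0; have [z Ez xz] := H _ e0.
have [zx|zx] := eqVneq z x; last by exists z; split => //; case: Ez.
by have [_ ] := Ez; rewrite zx; exact.
Qed.

(** Used to show that a polynomial small on [sigma_ess mu] is large at finitely many points of the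
    support only: infinitely many would accumulate in [sigma_ess mu]. *)
Lemma sigma_ess_limit_point mu (A : set R) x : A `<=` msupp mu ->
  limit_point A x -> sigma_ess mu x.
Proof.
move=> Asupp Ax.
have lim (e : R) : 0 < e -> exists y, [/\ y != x, A y & `|x - y| < e].
  move=> e0; have [y [yx Ay xy]] := Ax _ (nbhsx_ballx x e e0).
  by exists y.
split.
  apply: msupp_closed => U /nbhs_ballP[e /= e0 eU].
  have [y [_ Ay xy]] := lim _ e0.
  by exists y; split; [exact: Asupp|exact: eU].
by move=> e /lim[y [yx Ay xy]]; exists y; split => //; exact: Asupp.
Qed.

Lemma measure_bigcup0 mu (G : nat -> set R) :
  (forall k, measurable (G k)) -> (forall k, mu (G k) = 0%E) ->
  mu (\bigcup_k G k) = 0%E.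
Proof.
move=> mG G0; apply/eqP; rewrite -measure_le0.
apply: (le_trans (measure_sigma_subadditive _ mG _ (@subset_refl _ _))).
  exact: bigcup_measurable.
by rewrite eseries0.
Qed.

(** Every point off the support lies in a null interval with rational end points, and there are
    countably many of these; [G] enumerates them. *)
Lemma msuppC0 mu : mu (~` msupp mu) = 0%E.
Proof.
have mS : measurable (~` msupp mu).
  by apply: measurableC; apply: closed_measurable; exact: msupp_closed.
pose I (q : rat * rat) : set R := `]ratr q.1, ratr q.2[%classic.
pose G k := if unpickle k is Some q then
  if mu (I q) == 0%E then I q else set0 else set0.
have mG k : measurable (G k).
  rewrite /G; case: unpickle => [q|]//.
  by case: ifP => // _; exact: measurable_itv.
have G0 k : mu (G k) = 0%E.
  rewrite /G; case: unpickle => [q|]; last exact: measure0.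
  by case: ifP => [/eqP//|_]; exact: measure0.
apply: (subset_measure0 mS _ _ (measure_bigcup0 mG G0)).
  exact: bigcup_measurable.
move=> x /existsNP[e /not_implyP[e0 /negP]]; rewrite -leNgt measure_le0 => /eqP xe.
have [p] : exists p : rat, ratr p \in `]x - e, x[ by apply: rat_in_itvoo; lra.
have [q] : exists q : rat, ratr q \in `]x, x + e[ by apply: rat_in_itvoo; lra.
rewrite !in_itv/= => /andP[xq qx] /andP[px xp].
have Ipq : mu (I (p, q)) = 0%E.
  apply: (subset_measure0 _ _ _ xe).
  - exact: measurable_itv.
  - exact: measurable_ball.
  move=> y; rewrite /I/= in_itv/= => /andP[py yq].
  by rewrite /ball/= ltr_norml; apply/andP; split; lra.
exists (pickle (p, q)); first by [].
rewrite /G pickleK Ipq eqxx.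
by rewrite /I/= in_itv/= xp xq.
Qed.

End support.

(** * Upper bound by test polynomials *)

Section upper_bound.
Variable R : realType.
Implicit Types (x y z r D : R) (E : set R) (p : {poly R}).

(** Otherwise [exists_low_energy] would give a probability measure on [E] of logarithmic energy at
    most [- ln r], below the infimum [robin E]. *)
Lemma exists_small_poly E D r : compact E -> 0 < r -> 1 <= D ->
  (forall x y, E x -> E y -> `|x - y| <= D) -> ((- ln r)%:E < robin E)%E ->
  exists2 p, p \is monic & forall x, E x -> `|p.[x]| < r ^+ (size p).-1.
Proof.
move=> cE r0 D1 ED rV; apply: contrapT => H.
have {}H p : p \is monic -> exists2 x, E x & r ^+ (size p).-1 <= `|p.[x]|.
  move=> pm; apply: contrapT => Hp; apply: H; exists p => // x Ex.
  by rewrite ltNge; apply/negP => xp; apply: Hp; exists x.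
have mE : measurable E.
  by apply: closed_measurable; apply: compact_closed => //; exact: Rhausdorff.
have [nu [nuE nur]] := exists_low_energy cE r0 D1 ED H.
move: rV; rewrite ltNge => /negP; apply.
apply: (@le_trans _ _ (log_energy nu)).
  by apply: ereal_inf_lbound; exists nu.
rewrite (log_energyE D1 mE nuE ED).
apply: le_trans (leeB nur (lexx _)) _.
by rewrite -EFinB lee_fin; lra.
Qed.

Lemma horner_XsubC_prod_le (s : seq R) x (B : R) : (forall z, z \in s -> `|z| <= B) ->
  `|x| <= B -> `|(\prod_(z <- s) ('X - z%:P)).[x]| <= (2 * B) ^+ size s.
Proof.
move=> sB xB; rewrite horner_prod normr_prod.
have -> : (2 * B) ^+ size s = \prod_(z <- s) (2 * B).
  by rewrite big_const_seq count_predT iter_mulr_1.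
rewrite big_seq [leRHS]big_seq; apply: ler_prod => z zs.
rewrite normr_ge0/= hornerXsubC (le_trans (ler_normB _ _))//.
by rewrite mulr_natl mulr2n lerD// sB.
Qed.

(** The test polynomial is a power of [p], times the polynomial [w] vanishing at the finitely many
    points of the support where [p] is too large, times a power of ['X] that completes the degree.
    The last two factors have bounded degree and cost only the constant [A]. *)
Lemma monic_L2_min_le_cst (mu : {finite_measure set R -> \bar R}) p r :
  compact (msupp mu) -> 0 < r -> p \is monic -> (1 < size p)%N ->
  (forall x, sigma_ess mu x -> `|p.[x]| < r ^+ (size p).-1) ->
  exists A : R, 0 < A /\
    \forall n \near \oo, (monic_L2_min mu n <= (A * r ^+ n.*2)%:E)%E.
Proof.
move=> cS r0 pm sp pE; set N := (size p).-1 in pE.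
have N0 : (0 < N)%N by rewrite /N -subn1 subn_gt0.
pose F := [set x | msupp mu x /\ r ^+ N <= `|p.[x]|].
have FS : F `<=` msupp mu by move=> x [].
have bS : \forall B \near +oo, forall x, msupp mu x -> `|x| <= B.
  exact: compact_bounded cS.
have bF : bounded_set F by apply: filterS bS => B BS x [Sx _]; exact: BS.
have finF : finite_set F.
  apply: contrapT => infF.
  have [t Ft] := infinite_bounded_limit_point_nonempty infF bF.
  have := pE _ (sigma_ess_limit_point FS Ft); apply/negP; rewrite -leNgt.
  have cp : closed [set x | r ^+ N <= `|p.[x]|].
    apply: (@preimage_closed _ _ (fun x => `|p.[x]|) [set y | r ^+ N <= y]).
      move=> x _; apply: continuous_comp; first exact: continuous_horner.
      exact: norm_continuous.
    exact: closed_ge.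
  apply: cp; move=> U Ut; have [y [_ Fy Uy]] := Ft _ Ut.
  by exists y; split => //; case: Fy.
have [s sF] := (finite_seqP F).1 finF.
have [B [B1 SB]] : exists B : R, 1 <= B /\ forall x, msupp mu x -> `|x| <= B.
  have [B [SB B1]] := filter_ex (filterI bS (nbhs_pinfty_ge (num_real 1))).
  by exists B.
have sB z : z \in s -> `|z| <= B.
  by move=> zs; apply/SB/FS; rewrite sF.
(* [2 * B] bounds ['X] and the factors of [w] on the support; [r^-1] compensates the missing powers
   of [r]. *)
pose G := Num.max (2 * B) r^-1.
have G1 : 1 <= G by rewrite le_max; apply/orP; left; lra.
have BG : 2 * B <= G by rewrite le_max lexx.
have rG : r^-1 <= G by rewrite le_max lexx orbT.
have G0 : 0 <= G by exact: le_trans G1.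
set M := size s.
(* One half of the exponent bounds [w * 'X^j], the other makes up for [r ^+ (M + j)]. In [A] below,
   the added 1 ensures positivity when [mu] is zero. *)
pose C := G ^+ (2 * (M + N)).
have C1 : 1 <= C by exact: exprn_ege1.
pose A := C ^+ 2 * (fine (mu setT) + 1).
have muT : mu setT = (fine (mu setT))%:E by rewrite fineK// fin_num_measure.
have muT0 : 0 <= fine (mu setT) by exact: fine_ge0.
exists A; split.
  by apply: mulr_gt0; [rewrite exprn_gt0 ?(lt_le_trans ltr01)|exact: ltr_wpDl].
near=> n.
have Mn : (M <= n)%N by near: n; exact: nbhs_infty_ge.
pose q := ((n - M) %/ N)%N; pose j := ((n - M) %% N)%N.
have nE : n = (q * N + M + j)%N by rewrite addnAC -divn_eq subnK.
have jN : (j <= N)%N by rewrite ltnW// ltn_mod.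
pose w := \prod_(z <- s) ('X - z%:P).
pose Q := p ^+ q * w * 'X^j.
have wm : w \is monic by exact: monic_prod_XsubC.
have Qm : Q \is monic by rewrite !monicMl ?monicXn ?monic_exp.
have sQ : size Q = n.+1.
  have pqm : p ^+ q \is monic by exact: monic_exp.
  rewrite size_Mmonic ?monicXn ?monic_neq0 ?monicMl// size_polyXn.
  rewrite size_Mmonic ?monic_neq0// size_prod_XsubC -/M.
  have : (0 < size (p ^+ q))%N by rewrite size_poly_gt0 monic_neq0.
  have := size_exp p q; rewrite -/N.
  case: (size (p ^+ q)) => // k /= -> _.
  by rewrite addnS/= addnS/= nE mulnC.
have QS x : msupp mu x -> `|Q.[x]| <= r ^+ n * C.
  move=> Sx; have rC0 : 0 <= r ^+ n * C.
    by rewrite mulr_ge0 ?exprn_ge0 ?(ltW r0)// (le_trans ler01).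
  rewrite !hornerM !normrM horner_exp hornerXn !normrX.
  have [Fx|nFx] := pselect (F x).
    have /rootP -> : root w x by rewrite root_prod_XsubC; move: Fx; rewrite sF.
    by rewrite normr0 mulr0 mul0r.
  have px : `|p.[x]| <= r ^+ N.
    by rewrite leNgt; apply/negP => rx; apply: nFx; split => //; exact: ltW.
  have -> : r ^+ n * C = (r ^+ N) ^+ q * (r ^+ M * r ^+ j * C).
    by rewrite -exprM mulnC !mulrA -!exprD -nE.
  rewrite -mulrA ler_pM ?exprn_ge0 ?mulr_ge0//.
    by rewrite lerXn2r ?nnegrE ?exprn_ge0 ?(ltW r0).
  have -> : r ^+ M * r ^+ j * C = r ^+ (M + j) * G ^+ (M + N) * G ^+ (M + N).
    by rewrite -exprD -mulrA -exprD addnn -mul2n.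
  apply: (@le_trans _ _ (G ^+ (M + N))).
    rewrite exprD ler_pM//.
      apply: le_trans (horner_XsubC_prod_le sB (SB _ Sx)) _.
      by rewrite lerXn2r ?nnegrE// mulr_ge0// (le_trans ler01).
    apply: (@le_trans _ _ (G ^+ j)); last by rewrite ler_weXn2l.
    by rewrite lerXn2r ?nnegrE// (le_trans (SB _ Sx))//; lra.
  rewrite ler_peMl ?exprn_ge0//.
  apply: (@le_trans _ _ (r ^+ (M + j) * G ^+ (M + j))).
    by rewrite -exprMn exprn_ege1// -ler_pdivrMl// mulr1.
  by rewrite ler_wpM2l ?exprn_ge0 ?(ltW r0)// ler_weXn2l// leq_add2l.
apply: (@le_trans _ _ (\int[mu]_x ((Q.[x]) ^+ 2)%:E)%E).
  by apply: ereal_inf_lbound; exists Q.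
apply: (@le_trans _ _ (\int[mu]_x (cst ((r ^+ n * C) ^+ 2)%:E) x)%E).
  apply: ae_ge0_le_integral => //.
  - by move=> x _; rewrite lee_fin sqr_ge0.
  - by apply/measurable_EFinP; apply: measurable_funX; exact: measurable_poly.
  - by move=> x _; rewrite lee_fin sqr_ge0.
  exists (~` msupp mu); split; last 1 first.
  - move=> x /= nx Sx; apply: nx => _; rewrite lee_fin.
    rewrite -real_normK ?num_real// lerXn2r ?nnegrE ?QS//.
    by rewrite mulr_ge0 ?exprn_ge0 ?(ltW r0)// (le_trans ler01).
  - by apply: measurableC; apply: closed_measurable; exact: msupp_closed.
  - exact: msuppC0.
have -> : (\int[mu]_x (cst ((r ^+ n * C) ^+ 2)%:E) x =
    ((r ^+ n * C) ^+ 2 * fine (mu setT))%:E)%E.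
  by rewrite integral_cst// [RHS]EFinM; congr (_ * _)%E; exact: muT.
rewrite lee_fin.
rewrite /A exprMn -exprM muln2 -[leRHS]mulrC -mulrA ler_wpM2l ?exprn_ge0 ?(ltW r0)//.
by rewrite ler_wpM2l ?sqr_ge0// lerDl.
Unshelve. all: by end_near. Qed.

(** The constant [A] obtained for an intermediate [r1] is absorbed by [(r1 / r) ^+ n.*2], which
    tends to 0. *)
Lemma monic_L2_min_le (mu : {finite_measure set R -> \bar R}) D (V r : R) :
  compact (msupp mu) -> 1 <= D ->
  (forall x y, sigma_ess mu x -> sigma_ess mu y -> `|x - y| <= D) ->
  sigma_ess mu !=set0 ->
  robin (sigma_ess mu) = V%:E -> expR (- V) < r ->
  \forall n \near \oo, (monic_L2_min mu n <= (r ^+ n.*2)%:E)%E.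
Proof.
move=> cS D1 ED [x0 Ex0] rV Vr.
pose r1 := (expR (- V) + r) / 2.
have e0 := expR_gt0 (- V).
have r10 : 0 < r1 by rewrite /r1; lra.
have r1r : r1 < r by rewrite /r1; lra.
have Vr1 : expR (- V) < r1 by rewrite /r1; lra.
have r0 : 0 < r by exact: lt_trans r1r.
have cE : compact (sigma_ess mu).
  by apply: (subclosed_compact (@sigma_ess_closed _ mu) cS) => x [].
have [p pm pE] : exists2 p, p \is monic &
    forall x, sigma_ess mu x -> `|p.[x]| < r1 ^+ (size p).-1.
  apply: (exists_small_poly cE r10 D1 ED).
  rewrite rV lte_fin ltrNl -[ltLHS]expRK ltr_ln ?posrE//.
(* A constant monic polynomial is 1, which is not below [r1 ^+ 0] at the point [x0]. *)
have sp : (1 < size p)%N.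
  rewrite ltnNge; apply/negP => sp.
  have p1 : size p = 1%N.
    by apply/eqP; rewrite eqn_leq sp size_poly_gt0 monic_neq0.
  have := pE _ Ex0; rewrite p1 expr0.
  have [c _ pc] := size_poly1P _ (introT eqP p1).
  by move: pm; rewrite pc monicE lead_coefC => /eqP ->; rewrite hornerC normr1 ltxx.
have [A [A0 HA]] := monic_L2_min_le_cst cS r10 pm sp pE.
have q0 : 0 <= r1 / r by apply: divr_ge0; exact: ltW.
have q1 : `|(r1 / r) ^+ 2| < 1.
  rewrite ger0_norm ?sqr_ge0// expr_lt1//.
  by rewrite ltr_pdivrMr// mul1r.
have A10 : 0 < A^-1 by rewrite invr_gt0.
near=> n; apply: (@le_trans _ _ (A * r1 ^+ n.*2)%:E); first by near: n.
rewrite lee_fin.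
have qA : (r1 / r) ^+ n.*2 < A^-1.
  rewrite -mul2n exprM.
  suff : `|0 - (r1 / r) ^+ 2 ^+ n| < A^-1.
    by rewrite sub0r normrN ger0_norm// exprn_ge0// sqr_ge0.
  by near: n; move/cvgrPdist_lt : (cvg_expr q1); exact.
rewrite -ler_pdivlMl// mulrC; move: qA.
by rewrite expr_div_n ltr_pdivrMr ?exprn_gt0// => /ltW; rewrite mulrC.
Unshelve. all: by end_near. Qed.

Lemma powR_invn_bounds (a c r : R) n : (0 < n)%N -> 0 <= c -> 0 <= r ->
  c ^+ n <= a <= r ^+ n -> c <= a `^ n%:R^-1 <= r.
Proof.
move=> n0 c0 r0 /andP[ca ar].
have a0 : 0 <= a by apply: le_trans ca; exact: exprn_ge0.
have key (b : R) : 0 <= b -> (b ^+ n) `^ n%:R^-1 = b.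
  by move=> b0; rewrite -powR_mulrn// -powRrM divff ?powRr1// pnatr_eq0 -lt0n.
apply/andP; split.
  by rewrite -{1}(key c c0) ge0_ler_powR ?nnegrE ?exprn_ge0.
by rewrite -[leRHS](key r r0) ge0_ler_powR ?nnegrE ?exprn_ge0.
Qed.

End upper_bound.

(** * Convergence of the roots of the norms to the capacity *)

Unset Implicit Arguments.

Theorem theorem1p10 (R : realType) (mu : {finite_measure set R -> \bar R}) :
  compact (msupp mu) ->
  (0 < capacity (sigma_ess mu))%E ->
  (exists rho : probability R R,
      equilibrium_measure (sigma_ess mu) rho /\ rho `<< mu) ->
  regular_measure mu.
Proof.
move=> cS cap0 [rho [eq_rho rhomu]]; have [rhoE rhoV] := eq_rho.
set E := sigma_ess mu in cap0 eq_rho rhoE rhoV.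
have mE : measurable E by apply: closed_measurable; exact: sigma_ess_closed.
have bS : \forall B \near +oo, forall x, msupp mu x -> `|x| <= B.
  exact: compact_bounded cS.
have [B [SB B1]] := filter_ex (filterI bS (nbhs_pinfty_ge (num_real (1 : R)))).
have EB x : E x -> - B <= x <= B by move=> [/SB]; rewrite ler_norml.
pose D := B - - B.
have D1 : 1 <= D by rewrite /D; move: B1 => /= B1; lra.
have ED x y : E x -> E y -> `|x - y| <= D.
  move=> /EB/andP[? ?] /EB/andP[? ?].
  by rewrite /D ler_norml; apply/andP; split; lra.
have EI : E `<=` `[- B, B] by move=> x /EB; rewrite /= in_itv.
have BB : - B <= B by move: B1 => /= B1; lra.
have E0 : E !=set0.
  apply: contrapT => nE; move: rhoE; rewrite /prob_on (_ : ~` E = setT).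
    by rewrite probability_setT => /eqP; rewrite onee_eq0.
  by apply/seteqP; split => // x _ Ex; apply: nE; exists x.
have energyE := log_energyE D1 mE rhoE ED.
(* Positive capacity excludes [+oo], and the nonnegative shifted energy excludes [-oo]. *)
have [V rV] : exists V : R, robin E = V%:E.
  move: cap0 energyE; rewrite /capacity -rhoV.
  have := energy_ge0 D rho; case: (energy D rho) => [v| |]// _ cap0 logE.
    by exists (v - ln D); rewrite logE EFinB.
  by move: cap0; rewrite logE /= ltxx.
pose v := V + ln D.
have rhov : energy D rho = v%:E.
  move: energyE; rewrite rhoV rV; have := energy_ge0 D rho.
  by case: (energy D rho) => [w| |]// _ [Vw]; rewrite /v Vw subrK.
have v0 : 0 <= v by rewrite -lee_fin -rhov energy_ge0.
have pot_le z : - B <= z <= B -> (potential D rho z <= v%:E)%E.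
  apply: (potential_le_everywhere mE rhoE EI (lexx _)).
  apply: (potential_le_ae rhov rhoE mE) => nu.
  exact: robin_energy_le.
have low c : 0 < c -> c < expR (- V) ->
    \forall n \near \oo, ((c ^+ n.*2)%:E <= monic_L2_min mu n)%E.
  move=> c0 cV; pose c' := (c + expR (- V)) / 2.
  have cc' : c < c' by rewrite /c'; lra.
  have c'V : c' < expR (- V) by rewrite /c'; lra.
  have vc' : v < ln D - ln c'.
    have : ln c' < - V by rewrite -[ltRHS]expRK ltr_ln ?posrE ?expR_gt0// (lt_trans c0).
    by rewrite /v => ?; lra.
  have := monic_L2_ge mE rhoE EI BB (lexx _) rhomu pot_le v0 c0 cc' vc'.
  apply: filterS => n H; apply: le_ereal_inf_tmp => _ [p [pm sp] <-].
  exact: H.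
rewrite /regular_measure -/E /capacity rV /=.
apply/fine_cvgP; split; first exact: nearW.
have eV := expR_gt0 (- V).
apply/cvgrPdist_le => e e0 /=.
(* The first term keeps [c] positive when [e] is large. *)
pose c := Num.max (expR (- V) / 2) (expR (- V) - e).
have c0 : 0 < c by rewrite lt_max; apply/orP; left; lra.
have cV : c < expR (- V) by rewrite gt_max; apply/andP; split; lra.
have ce : expR (- V) - e <= c by rewrite le_max lexx orbT.
have Vr : expR (- V) < expR (- V) + e by rewrite ltrDl.
near=> n.
have n0 : (0 < n.*2)%N.
  by rewrite double_gt0; near: n; exact: nbhs_infty_gt.
have lowL : ((c ^+ n.*2)%:E <= monic_L2_min mu n)%E by near: n; exact: low.
have uppL : (monic_L2_min mu n <= ((expR (- V) + e) ^+ n.*2)%:E)%E.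
  by near: n; apply: (monic_L2_min_le cS D1 ED E0 rV).
(* Between two real bounds the minimum is finite, so [fine] keeps its value. *)
have [a aE] : exists a : R, monic_L2_min mu n = a%:E.
  by move: lowL uppL; case: (monic_L2_min mu n) => [a| |]// _ _; exists a.
rewrite aE in lowL uppL *; rewrite !lee_fin in lowL uppL.
have Ve0 : 0 <= expR (- V) + e by lra.
have := powR_invn_bounds n0 (ltW c0) Ve0 (introT andP (conj lowL uppL)).
move=> /andP[? ?] /=; rewrite ler_norml; apply/andP; split; lra.
Unshelve. all: by end_near. Qed.
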